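(* Let $f:\mathbb{R}^n\to\mathbb{R}$ and $g:\mathbb{R}^n\to\mathbb{R}^m$ be twice continuously differentiable, let $\Lambda\subseteq\mathbb{R}^m$ be closed, and let $\bar x$ be a local optimal solution of the problem (P): $\min f(x)$ s.t. $g(x)\in\Lambda$. Suppose that for $d\in C(\bar x)$ the directional non-degeneracy condition $$\nabla g(\bar x)^T\lambda=0,\ \lambda\in\mathrm{span}\,N_\Lambda(g(\bar x);\nabla g(\bar x)d)\ \Longrightarrow\ \lambda=0$$ holds. Then $\Lambda^s(\bar x;d)=\Lambda(\bar x;d)=\Lambda^c(\bar x;d)=\{\lambda_0\}$ is a singleton, and $$\nabla^2_{xx}L(\bar x,\lambda_0)(d,d)-\sigma_{T^2_\Lambda(g(\bar x);\nabla g(\bar x)d)}(\lambda_0)\ge0.$$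
   Context: $\nabla g(x)\in\mathbb{R}^{m\times n}$ is the Jacobian, $\nabla f(x)$ is viewed as a row vector. The Lagrangian is $L(x,\lambda):=f(x)+g(x)^T\lambda$; $\nabla_xL$ is its gradient in $x$ and $\nabla^2_{xx}L(\bar x,\lambda)(d,d)=d^T\nabla^2_{xx}L(\bar x,\lambda)d$. For $x\in S$, $T_S(x):=\{d: \exists t_k\downarrow0,\ d_k\to d,\ x+t_kd_k\in S\}$; for $d\in T_S(x)$, $T^2_S(x;d):=\{w:\exists t_k\downarrow 0,\ w_k\to w,\ x+t_kd+\tfrac12t_k^2w_k\in S\}$. Critical cone: $C(\bar x):=\{d:\nabla g(\bar x)d\in T_\Lambda(g(\bar x)),\ \nabla f(\bar x)d\le0\}$. For $x\in S$, $\widehat N_S(x):=\{v:\langle v,x'-x\rangle\le o(\|x'-x\|)\ \forall x'\in S\}$ (empty if $x\notin S$). Directional limiting normal cone: $N_S(x;d):=\{v:\exists t_k\downarrow0,\ d_k\to d,\ v_k\to v,\ v_k\in\widehat N_S(x+t_kd_k)\}$. Directional Clarke normal cone: $N^c_S(x;d):=\mathrm{cl}\,\mathrm{co}\,N_S(x;d)$. $\mathrm{span}$ denotes the affine hull, which here is the linear span since the cone contains $0$. Multiplier sets: $\Lambda(\bar x;d):=\{\lambda:\nabla_xL(\bar x,\lambda)=0,\ \lambda\in N_\Lambda(g(\bar x);\nabla g(\bar x)d)\}$; $\Lambda^c(\bar x;d):=\{\lambda:\nabla_xL(\bar x,\lambda)=0,\ \lambda\in N^c_\Lambda(g(\bar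 x);\nabla g(\bar x)d)\}$; strong multipliers in direction $d$: $\Lambda^s(\bar x;d):=\{\lambda:\nabla_xL(\bar x,\lambda)=0,\ \lambda\in\widehat N_{T_\Lambda(g(\bar x))}(\nabla g(\bar x)d)\}$. Support function: $\sigma_S(\lambda):=\sup\{\lambda^Tu:u\in S\}$, with $\sigma_\emptyset\equiv-\infty$. *)

(* Defs.v *)
From mathcomp Require Import all_boot all_order all_algebra.
From mathcomp Require Import all_classical all_reals all_analysis.

Set Implicit Arguments.
Unset Strict Implicit.
Unset Printing Implicit Defensive.

Import Order.TTheory GRing.Theory Num.Theory.
Import numFieldNormedType.Exports.

Local Open Scope classical_set_scope.
Local Open Scope ring_scope.

(* Points of R^n are row vectors.  Accordingly the library Jacobian 'J g x has
   size n x m and is the transpose of the textbook one: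
     (nabla g(x)) d        is written  d *m 'J g x,
     (nabla g(x))^T lambda is written  lambda *m ('J g x)^T.
   The library norm on row vectors is the maximum norm; every notion below is
   invariant under a change of equivalent norm. *)

Section Smoothness.
Variables (R : realType) (U V : normedModType R).

(* The derivative is only required to be continuous (resp. C^1) along each
   fixed direction v; for finite-dimensional U, the only case used below, this
   is the same as x |-> 'd F x being continuous (resp. C^1) as a map into the
   normed space of linear maps. *)
Definition C1 (F : U -> V) : Prop :=
  (forall x, differentiable F x) /\
  (forall v, continuous (fun x => 'd F x v)).

Definition C2 (F : U -> V) : Prop :=
  (forall x, differentiable F x) /\ (forall v, C1 (fun x => 'd F x v)).

End Smoothness.

Section VariationalGeometry.
Variables (R : realType) (n : nat).
Implicit Types (S : set 'rV[R]_n) (x d u v : 'rV[R]_n).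

Definition dot u v : R := (u *m v^T) 0 0.

Definition downto0 (t : nat -> R) : Prop :=
  (forall k, 0 < t k) /\ t @ \oo --> (0 : R).

Definition tangent_cone S x : set 'rV[R]_n :=
  [set d | exists (t : nat -> R) (dk : nat -> 'rV[R]_n),
    [/\ downto0 t, dk @ \oo --> d & forall k, S (x + t k *: dk k)]].

Definition second_tangent_set S x d : set 'rV[R]_n :=
  [set w | exists (t : nat -> R) (wk : nat -> 'rV[R]_n),
    [/\ downto0 t, wk @ \oo --> w &
        forall k, S (x + t k *: d + (2^-1 * t k ^+ 2) *: wk k)]].

Definition regular_normal_cone S x : set 'rV[R]_n :=
  [set v | S x /\ forall e : R, 0 < e ->
    \forall y \near x, S y -> dot v (y - x) <= e * `|y - x|].

Definition dir_normal_cone S x d : set 'rV[R]_n :=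
  [set v | exists (t : nat -> R) (dk vk : nat -> 'rV[R]_n),
    [/\ downto0 t, dk @ \oo --> d, vk @ \oo --> v &
        forall k, regular_normal_cone S (x + t k *: dk k) (vk k)]].

Definition convex_hull S : set 'rV[R]_n :=
  smallest (fun A : set 'rV[R]_n => convex_set A) S.

Definition dir_clarke_normal_cone S x d : set 'rV[R]_n :=
  closure (convex_hull (dir_normal_cone S x d)).

Definition affine_set S : Prop :=
  forall u v (a : R), S u -> S v -> S (a *: u + (1 - a) *: v).

Definition affine_hull S : set 'rV[R]_n := smallest affine_set S.

(* ereal_sup set0 = -oo *)
Definition support_function S v : \bar R :=
  ereal_sup [set (dot v u)%:E | u in S].

Definition gradient (F : 'rV[R]_n -> R^o) x : 'rV[R]_n :=
  \row_j ('d F x (delta_mx 0 j) : R).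

Definition hessian (F : 'rV[R]_n -> R^o) x : 'M[R]_n := 'J (gradient F) x.

End VariationalGeometry.

Section Problem.
Variables (R : realType) (n m : nat).
Variables (f : 'rV[R]_n -> R^o) (g : 'rV[R]_n -> 'rV[R]_m).
Variable Lam : set 'rV[R]_m.
Implicit Types (x d : 'rV[R]_n) (l : 'rV[R]_m).

Definition local_optimal_solution x : Prop :=
  Lam (g x) /\ \forall y \near x, Lam (g y) -> f x <= f y.

Definition lagrangian l x : R^o := f x + dot (g x) l.

Definition critical_cone x : set 'rV[R]_n :=
  [set d | tangent_cone Lam (g x) (d *m 'J g x) /\ dot (gradient f x) d <= 0].

Definition multipliers x d : set 'rV[R]_m :=
  [set l | gradient (lagrangian l) x = 0 /\
           dir_normal_cone Lam (g x) (d *m 'J g x) l].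

Definition clarke_multipliers x d : set 'rV[R]_m :=
  [set l | gradient (lagrangian l) x = 0 /\
           dir_clarke_normal_cone Lam (g x) (d *m 'J g x) l].

Definition strong_multipliers x d : set 'rV[R]_m :=
  [set l | gradient (lagrangian l) x = 0 /\
           regular_normal_cone (tangent_cone Lam (g x)) (d *m 'J g x) l].

(* As N_Lam(g(x); nabla g(x) d) contains 0 for d in the critical cone, the
   affine hull here is the linear span. *)
Definition dir_nondegenerate x d : Prop :=
  forall l, l *m ('J g x)^T = 0 ->
    affine_hull (dir_normal_cone Lam (g x) (d *m 'J g x)) l -> l = 0.

End Problem.

(* Main.v *)
Require Import Defs.
From HB Require Import structures.
From mathcomp Require Import all_boot all_order all_algebra.
From mathcomp Require Import all_classical all_reals all_analysis.
From mathcomp Require Import ring lra.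
Import Order.TTheory GRing.Theory Num.Theory.
Import numFieldNormedType.Exports.
Local Open Scope classical_set_scope.
Local Open Scope ring_scope.

Set Implicit Arguments.
Unset Strict Implicit.
Unset Printing Implicit Defensive.

(** Write y for g(xb), J for the derivative of g at xb, e = J d, N for the
    directional limiting normal cone N_Lam(y; e), and W for the orthogonal
    complement of N.  Non-degeneracy is dual to the statement that the range of
    J and W together span the whole space, so every vector splits linearly as
    v = J (u v) + w v with w v in W (transversal_splitting).

    Two facts hold near y inside a thin cone around the ray in direction e.
    First, Lam is almost invariant under W: a point of Lam moved by w in W
    stays within o(|w|) of Lam (shift_almost_stays), since a point where the
    distance to Lam grows at a definite rate along w carries a proximal normal
    that is not almost orthogonal to w, and limits of such normals lie in N.
    Secondly, the system g(x) in Lam is metrically subregular in direction d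
    (metric_subregularity): a minimizer of a suitably penalized residual has a
    residual that is a proximal normal, thus almost orthogonal to W; being
    almost seen through the range of J, it can be decreased at a definite rate
    by a step in x (residual_slope), so it must vanish.
    Together they turn a point x with g(x) = p + w + small, p in Lam, w in W,
    into a feasible one (feasible_correction), and local minimality of xb
    becomes the estimate f(xb) <= f(x) + K (|g(x) - p - w| + eps |w|)
    (exact_penalty).

    Everything else is read off this estimate.  At x = xb + t (d + u), with
    e + J u + w a tangent direction of Lam at y, it gives
    f'(xb) (d + u) >= - eps |w| for small u and w.  Hence f'(xb) d = 0,
    f'(xb) vanishes on the preimage of W under J, and v |-> - f'(xb) (u v)
    defines a vector l0 that satisfies the Lagrange equation and is a regular
    normal to T_Lam(y) at e.  Regular normals to the tangent cone at e belong to
    N (regular_normal_tangent_cone), so the three multiplier sets are nested and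
    all contain l0; the difference of two Clarke multipliers lies in the span of
    N and in the kernel of the transpose of J, hence vanishes.

    At x = xb + t d + (t^2/2) z with z = u (w - g''(xb)(d, d)) and w a
    second-order tangent vector, the same estimate yields
    0 <= f'(xb) z + f''(xb)(d, d), which is the second-order condition because
    f'(xb) z = - <l0, w - g''(xb)(d, d)>. *)

(** * Inner product and maximum norm *)

Section Dot.
Variables (R : realType) (n : nat).
Implicit Types (u v w : 'rV[R]_n) (a : R).

Lemma dotE u v : dot u v = \sum_i u 0 i * v 0 i.
Proof. by rewrite /dot mxE; apply: eq_bigr => i _; rewrite mxE. Qed.

Lemma dotC u v : dot u v = dot v u.
Proof. by rewrite !dotE; apply: eq_bigr => i _; rewrite mulrC. Qed.

Lemma dotDl u v w : dot (u + v) w = dot u w + dot v w.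
Proof. by rewrite /dot mulmxDl mxE. Qed.

Lemma dotDr u v w : dot u (v + w) = dot u v + dot u w.
Proof. by rewrite !(dotC u) dotDl. Qed.

Lemma dotZl a u v : dot (a *: u) v = a * dot u v.
Proof. by rewrite /dot -scalemxAl mxE. Qed.

Lemma dotZr a u v : dot u (a *: v) = a * dot u v.
Proof. by rewrite !(dotC u) dotZl. Qed.

Lemma dotNl u v : dot (- u) v = - dot u v.
Proof. by rewrite -scaleN1r dotZl mulN1r. Qed.

Lemma dotNr u v : dot u (- v) = - dot u v.
Proof. by rewrite !(dotC u) dotNl. Qed.

Lemma dotBl u v w : dot (u - v) w = dot u w - dot v w.
Proof. by rewrite dotDl dotNl. Qed.

Lemma dotBr u v w : dot u (v - w) = dot u v - dot u w.
Proof. by rewrite dotDr dotNr. Qed.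

Lemma dot0l v : dot 0 v = 0.
Proof. by rewrite -(scale0r v) dotZl mul0r. Qed.

Lemma dot0r v : dot v 0 = 0.
Proof. by rewrite dotC dot0l. Qed.

Lemma dot_delta u j : dot u (delta_mx 0 j) = u 0 j.
Proof.
rewrite dotE (bigD1 j) //= mxE !eqxx mulr1 big1 ?addr0 // => i ij.
by rewrite mxE eqxx (negPf ij) mulr0.
Qed.

Lemma normr_coord v i : `|v 0 i| <= `|v|.
Proof.
by rewrite [leRHS]/Num.Def.normr /= mx_normrE; apply/bigmax_geP; right => /=; exists (0, i).
Qed.

Lemma rV_norm_le v a : 0 <= a -> (forall i, `|v 0 i| <= a) -> `|v| <= a.
Proof.
move=> a0 H; rewrite [leLHS]/Num.Def.normr /= mx_normrE; apply/bigmax_leP.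
by split => // -[i j] _ /=; rewrite (ord1 i).
Qed.

Lemma norm_dot u v : `|dot u v| <= n%:R * `|u| * `|v|.
Proof.
rewrite dotE; apply: (le_trans (ler_norm_sum _ _ _)).
apply: (@le_trans _ _ (\sum_(i < n) (`|u| * `|v|))).
  by apply: ler_sum => i _; rewrite normrM ler_pM // normr_coord.
by rewrite sumr_const card_ord -[leLHS]mulr_natl mulrA.
Qed.

Lemma dot_le u v : dot u v <= n%:R * `|u| * `|v|.
Proof. exact: le_trans (ler_norm _) (norm_dot _ _). Qed.

Lemma dot_ge0 v : 0 <= dot v v.
Proof. by rewrite dotE; apply: sumr_ge0 => i _; rewrite -expr2 sqr_ge0. Qed.

Lemma norm_le_sqrt_dot v : `|v| <= Num.sqrt (dot v v).
Proof.
apply: rV_norm_le => [|i]; first exact: sqrtr_ge0.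
rewrite -(@ler_sqr R) ?nnegrE ?sqrtr_ge0 // sqr_sqrtr ?dot_ge0 //.
rewrite dotE (bigD1 i) //= real_normK ?num_real // -expr2 lerDl.
by apply: sumr_ge0 => k _; rewrite -expr2 sqr_ge0.
Qed.

Lemma sqr_norm_le_dot v : `|v| ^+ 2 <= dot v v.
Proof.
rewrite -[leRHS](sqr_sqrtr (dot_ge0 v)) ler_sqr ?nnegrE ?sqrtr_ge0 //; exact: norm_le_sqrt_dot.
Qed.

Lemma dot_gt0 v : v != 0 -> 0 < dot v v.
Proof.
move=> v0; apply: lt_le_trans (sqr_norm_le_dot v).
by rewrite exprn_gt0 // normr_gt0.
Qed.

Lemma dot_le_sqr_norm v : dot v v <= n%:R * `|v| ^+ 2.
Proof. by rewrite (le_trans (dot_le v v)) // -mulrA -expr2. Qed.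

Lemma cvg_dot T (F : set_system T) (FF : Filter F) (f g : T -> 'rV[R]_n) u v :
  f @ F --> u -> g @ F --> v -> dot (f x) (g x) @[x --> F] --> dot u v.
Proof.
move=> fu gv; rewrite dotE.
have -> : (fun x => dot (f x) (g x)) = (fun x => \sum_i f x 0 i * g x 0 i).
  by apply/funext => x; rewrite dotE.
apply: cvg_big => [|i _]; first exact: add_continuous.
have coord h w : h @ F --> w -> h x 0 i @[x --> F] --> (w 0 i : R).
  move=> hw; exact: (@continuous_cvg T _ _ F FF h (fun M : 'rV[R]_n => M 0 i : R) w
    (@coord_continuous R 1 n 0 i w) hw).
by apply: cvgM; apply: coord.
Qed.

End Dot.

Lemma dot_mulmx (R : realType) p n (u : 'rV[R]_n) (v : 'rV[R]_p) (A : 'M[R]_(p, n)) :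
  dot u (v *m A) = dot (u *m A^T) v.
Proof. by rewrite /dot trmx_mul mulmxA. Qed.

Lemma mulmx_bound (R : realType) p n (A : 'M[R]_(p, n)) :
  exists2 C, 0 < C & forall v : 'rV[R]_p, `|v *m A| <= C * `|v|.
Proof.
exists (\sum_(i < p) \sum_(j < n) `|A i j| + 1) => [|v].
  by rewrite ltr_wpDl // sumr_ge0 // => i _; rewrite sumr_ge0.
have S0 : 0 <= \sum_(i < p) \sum_(j < n) `|A i j|.
  by rewrite sumr_ge0 // => i _; rewrite sumr_ge0.
apply: rV_norm_le => [|j]; first by rewrite mulr_ge0 // addr_ge0.
rewrite mxE (le_trans (ler_norm_sum _ _ _)) //.
rewrite mulrDl mul1r ler_wpDr // mulr_suml ler_sum // => i _.
rewrite normrM mulrC ler_pM ?normr_coord //.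
by rewrite (bigD1 j) //= lerDl sumr_ge0.
Qed.

(** * Tangent and normal cones *)

Section Sequences.
Variable R : realType.

Lemma harmonic_cvg (V : normedModType R) (u : nat -> V) (l : V) :
  (forall k, `|u k - l| <= k.+1%:R^-1) -> u @ \oo --> l.
Proof.
move=> H; apply/cvgrPdist_le => e e0.
have := @cvg_harmonic R => /cvgrPdist_le /(_ _ e0); apply: filterS => k.
rewrite sub0r normrN ger0_norm ?invr_ge0 // => He.
by rewrite distrC (le_trans (H k)).
Qed.

Lemma downto0_harmonic (t : nat -> R) :
  (forall k, 0 < t k < k.+1%:R^-1) -> downto0 t.
Proof.
move=> H; split=> [k|]; first by case/andP: (H k).
apply: (@harmonic_cvg R^o) => k; rewrite subr0.
by case/andP: (H k) => tk0 tk; rewrite gtr0_norm // ltW.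
Qed.

(** Phrased with indices rather than filters: every tail of the sequence comes
    arbitrarily close to the cluster point. *)
Lemma bounded_cluster n (u : nat -> 'rV[R]_n) r : (forall k, `|u k| <= r) ->
  exists v, forall e N, 0 < e -> exists k, (N <= k)%N /\ `|u k - v| < e.
Proof.
move=> ur; have cA : compact [set v : 'rV[R]_n | `|v| <= r].
  apply: bounded_closed_compact.
    by exists r; split; [exact: num_real | move=> M rM v /= vr; rewrite (le_trans vr) // ltW].
  apply: (@closed_comp _ _ (fun v : 'rV[R]_n => `|v|) [set x | x <= r]).
    by move=> v _; exact: norm_continuous.
  exact: closed_le.
have [|v [_ cv]] := cA (u @ \oo).
  by exists 0%N => // k _ /=.
exists v => e N e0.
have [|_ [[k Nk <-] ukv]] := cv (u @` [set k | (N <= k)%N]) (ball v e) _ (nbhsx_ballx _ _ e0).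
  by exists N => // k Nk /=; exists k.
by exists k; split => //; move: ukv; rewrite -ball_normE /= distrC.
Qed.

Lemma downto0_common_index (V : normedModType R) (t : nat -> R) (u : nat -> V) l :
  downto0 t -> u @ \oo --> l -> forall e, 0 < e -> exists k, t k < e /\ `|u k - l| <= e.
Proof.
move=> [t0 tcvg] ucvg e e0.
have : \forall k \near \oo, t k < e /\ `|u k - l| <= e.
  near=> k; split.
    near: k; move/cvgrPdist_lt : tcvg => /(_ _ e0); apply: filterS => k.
    by rewrite sub0r normrN gtr0_norm.
  near: k; move/cvgrPdist_le : ucvg => /(_ _ e0); apply: filterS => k.
  by rewrite distrC.
by case=> N _ /(_ N (leqnn _)); exists N.
Unshelve. all: by end_near. Qed.

End Sequences.

Section Normals.
Variables (R : realType) (n : nat).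
Implicit Types (S : set 'rV[R]_n) (x d u v w q : 'rV[R]_n).

(** Membership can be tested at one scale at a time: choosing e = 1/(k+1)
    produces the sequences of the definition. *)
Lemma tangent_coneI S x d :
  (forall e, 0 < e -> exists t q, [/\ 0 < t < e, `|q - d| <= e & S (x + t *: q)]) ->
  tangent_cone S x d.
Proof.
move=> H.
have [s Hs] := choice (fun k : nat => H k.+1%:R^-1 ltac:(by rewrite invr_gt0)).
have [q Hq] := choice Hs.
exists s, q; split.
- by apply: downto0_harmonic => k; case: (Hq k).
- by apply: harmonic_cvg => k; case: (Hq k).
- by move=> k; case: (Hq k).
Qed.

Lemma tangent_coneE S x v : tangent_cone S x v -> forall e, 0 < e ->
  exists t q, [/\ 0 < t < e, `|q - v| <= e & S (x + t *: q)].
Proof.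
move=> [t [vk [t0 vcvg Sk]]] e e0.
have [k [tk vk_le]] := downto0_common_index t0 vcvg e0.
by exists (t k), (vk k); rewrite t0.1 tk.
Qed.

Lemma second_tangent_setE S x v w : second_tangent_set S x v w ->
  forall e, 0 < e -> exists t w', [/\ 0 < t < e, `|w' - w| <= e &
    S (x + t *: v + (2^-1 * t ^+ 2) *: w')].
Proof.
move=> [t [wk [t0 wcvg Sk]]] e e0.
have [k [tk wk_le]] := downto0_common_index t0 wcvg e0.
by exists (t k), (wk k); rewrite t0.1 tk.
Qed.

Lemma dir_normal_coneI S x d v :
  (forall e, 0 < e -> exists t q v', [/\ 0 < t < e,
     `|q - (x + t *: d)| <= e * t, regular_normal_cone S q v' & `|v' - v| <= e]) ->
  dir_normal_cone S x d v.
Proof.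
move=> H.
have [t Ht] := choice (fun k : nat => H k.+1%:R^-1 ltac:(by rewrite invr_gt0)).
have [q Hq] := choice Ht.
have [v' Hv] := choice Hq.
have t0 k : 0 < t k by case: (Hv k) => /andP[].
exists t, (fun k => (t k)^-1 *: (q k - x)), v'; split.
- by apply: downto0_harmonic => k; case: (Hv k).
- apply: harmonic_cvg => k; case: (Hv k) => _ Hk _ _.
  have -> : (t k)^-1 *: (q k - x) - d = (t k)^-1 *: (q k - (x + t k *: d)).
    by rewrite opprD addrA [RHS]scalerBr scalerA mulVf ?scale1r // gt_eqF.
  by rewrite normrZ gtr0_norm ?invr_gt0 // mulrC ler_pdivrMr.
- by apply: harmonic_cvg => k; case: (Hv k).
- move=> k; case: (Hv k) => _ _ + _.
  by rewrite scalerA divff ?gt_eqF // scale1r addrC subrK.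
Qed.

Lemma regular_normal_coneZ S x v a : 0 <= a ->
  regular_normal_cone S x v -> regular_normal_cone S x (a *: v).
Proof.
move=> a0 [Sx Hv]; split => // e e0.
have e'0 : 0 < e / (a + 1) by rewrite divr_gt0 // ltr_wpDl.
have := Hv _ e'0; apply: filterS => y H Sy; rewrite dotZl.
apply: (le_trans (ler_wpM2l a0 (H Sy))).
rewrite mulrA ler_wpM2r // mulrCA ler_piMr ?(ltW e0) //.
by rewrite ler_pdivrMr ?mul1r ?lerDl // ltr_wpDl.
Qed.

(** Expanding the square |a - q' |^2 around q leaves
    2 <a - q, q' - q> <= |q' - q|^2, and the right-hand side is o(|q' - q|). *)
Lemma proximal_normal S a q (r : R) : S q -> 0 < r ->
  (forall q', S q' -> `|q' - q| <= r -> dot (a - q) (a - q) <= dot (a - q') (a - q')) ->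
  regular_normal_cone S q (a - q).
Proof.
move=> Sq r0 H; split => // e e0.
have e'0 : 0 < e / n.+1%:R by rewrite divr_gt0.
near=> y => Sy.
have yr : `|y - q| <= r.
  have : ball q r y by near: y; exact: nbhsx_ballx.
  by rewrite -ball_normE /= distrC => /ltW.
have ye : `|y - q| <= e / n.+1%:R.
  have : ball q (e / n.+1%:R) y by near: y; exact: nbhsx_ballx.
  by rewrite -ball_normE /= distrC => /ltW.
have := H y Sy yr.
have -> : a - y = (a - q) - (y - q) by rewrite opprB addrA subrK.
move: (a - q) (y - q) yr ye => v h hr he.
rewrite dotBl 2!dotBr (dotC h v) => Hd.
have dd : dot h h <= e * `|h|.
  apply: (le_trans (dot_le _ _)); rewrite ler_wpM2r //.
  apply: (le_trans (ler_wpM2l _ he)) => //.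
  rewrite mulrCA ler_piMr ?(ltW e0) // ler_pdivrMr // mul1r ler_nat //.
have d0 := dot_ge0 h; lra.
Unshelve. all: by end_near. Qed.

(** Compactness: unit normals at points approaching x in direction d cluster at
    elements of the directional normal cone, so a uniform lower bound on
    <v, w> / |w| would survive in the limit. *)
Lemma normal_almost_orthogonal S x d (e : R) : 0 < e ->
  exists2 del, 0 < del & forall t q v w, 0 < t < del ->
    `|q - (x + t *: d)| <= del * t -> regular_normal_cone S q v ->
    (forall u, dir_normal_cone S x d u -> dot u w = 0) ->
    dot v w <= e * `|v| * `|w|.
Proof.
move=> e0; apply: contrapT => Hno.
have bad (k : nat) : exists p : R * 'rV[R]_n * 'rV[R]_n * 'rV[R]_n,
    let: (t, q, v, w) := p in
    [/\ 0 < t < k.+1%:R^-1, `|q - (x + t *: d)| <= k.+1%:R^-1 * t,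
      regular_normal_cone S q v, `|v| = 1 &
      (forall u, dir_normal_cone S x d u -> dot u w = 0) /\ e * `|w| < dot v w].
  apply: contrapT => Hk; apply: Hno; exists k.+1%:R^-1; rewrite ?invr_gt0 //.
  move=> t q v w Ht Hq Hv Hw; rewrite leNgt; apply/negP => Hlt.
  have v0 : v != 0.
    by apply/eqP => v0; move: Hlt; rewrite v0 dot0l normr0 mulr0 mul0r ltxx.
  apply: Hk; exists (t, q, `|v|^-1 *: v, w); split => //.
  - by apply: regular_normal_coneZ; rewrite ?invr_ge0.
  - by rewrite normrZ normfV normr_id mulVf // normr_eq0.
  - split => //; rewrite dotZl ltr_pdivlMl ?normr_gt0 //.
    by rewrite mulrA (mulrC `|v|).
have [p Hp] := choice bad.
have [v0 Hv0] : exists v, forall e N, 0 < e ->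
    exists k, (N <= k)%N /\ `|(p k).1.2 - v| < e.
  apply: (@bounded_cluster _ _ (fun k => (p k).1.2) 1) => k.
  by case: (p k) (Hp k) => -[[t q] v] w /= [_ _ _ -> _].
have v0N : dir_normal_cone S x d v0.
  apply: dir_normal_coneI => eta eta0.
  have [N _ HN] := near_infty_natSinv_lt (PosNum eta0).
  have [k [/HN/= Nk kv]] := Hv0 _ N eta0.
  case: (p k) (Hp k) kv => -[[t q] v] w /= [/andP[t0 tk] qk vq _ _] kv.
  exists t, q, v; split => //.
  - by rewrite t0 (lt_trans tk).
  - by rewrite (le_trans qk) // ler_wpM2r // ltW.
  - exact: ltW.
have [|k [_]] := Hv0 (e / n.+1%:R) 0%N; first by rewrite divr_gt0.
case: (p k) (Hp k) => -[[t q] v] w /= [_ _ _ _ [wN ew]] kv.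
have := dot_le (v - v0) w; rewrite dotBl (wN _ v0N) subr0 => vw.
have := lt_le_trans ew vw; apply/negP; rewrite -leNgt ler_wpM2r //.
apply: (le_trans (ler_wpM2l _ (ltW kv))) => //.
by rewrite mulrCA ler_piMr ?(ltW e0) // ler_pdivrMr // mul1r ler_nat.
Qed.

End Normals.

Section Projection.
Variables (R : realType) (n : nat).
Implicit Types (S : set 'rV[R]_n) (x d u v w q : 'rV[R]_n).

Lemma subr_ray x (t : R) q u : x + t *: q - (x + t *: u) = t *: (q - u).
Proof. by rewrite opprD addrACA subrr add0r scalerBr. Qed.

Lemma compact_cball S (c : 'rV[R]_n) (r : R) :
  closed S -> compact (S `&` [set q | `|q - c| <= r]).
Proof.
move=> Scl; apply: bounded_closed_compact.
  exists (r + `|c|); split; [exact: num_real | move=> M rM q [_ /= qr]].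
  rewrite -(subrK c q) (le_trans (ler_normD _ _)) // ltW // (le_lt_trans _ rM) //.
  by rewrite lerD2r.
apply: closedI => //.
apply: (@closed_comp _ _ (fun q : 'rV[R]_n => `|q - c|) [set s | s <= r]).
  move=> q _; have H : x - c @[x --> q] --> q - c.
    exact: (@cvgB R 'rV[R]_n _ (nbhs q) _ id (cst c) q c cvg_id (cvg_cst c)).
  exact: (cvg_norm H).
exact: closed_le.
Qed.

Lemma closest_point S a c r : closed S ->
  (exists2 p, S p & `|p - c| <= r) ->
  exists q, [/\ S q, `|q - c| <= r & forall q', S q' -> `|q' - c| <= r ->
    dot (a - q) (a - q) <= dot (a - q') (a - q')].
Proof.
move=> Scl [p Sp pr].
have [||q] := @compact_EVT_min _ R (fun q => dot (a - q) (a - q)) _ _ (@compact_cball S c r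
    Scl).
- by exists p.
- apply: continuous_subspaceT => q; have H : a - x @[x --> q] --> a - q.
    exact: (@cvgB R 'rV[R]_n _ (nbhs q) _ (cst a) id a q (cvg_cst a) cvg_id).
  exact: (@cvg_dot R n _ (nbhs q) _ (fun x => a - x) (fun x => a - x) _ _ H H).
- rewrite inE => -[Sq qr] H; exists q; split => // q' Sq' q'r.
  by apply: H; rewrite inE.
Qed.

(** For small eta, project x + t (d + eta v) onto S near x + t d along the scales
    t at which S approaches the direction d.  In the limit the projected points,
    rescaled, lie in the tangent cone, where <v, q - d> <= (e/3) |q - d|; this
    forces |q - d| <= eta e, so the proximal normals (d + eta v - q) / eta are
    within e of v. *)
Lemma regular_normal_tangent_cone S x d v : closed S ->
  regular_normal_cone (tangent_cone S x) d v -> dir_normal_cone S x d v.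
Proof.
move=> Scl [[t [dk [[t0 tcvg] dcvg Sdk]]] Hv].
apply: dir_normal_coneI => e e0.
have e3 : 0 < e / 3 by rewrite divr_gt0.
have [r /= r0 Hr] : exists2 r, 0 < r & forall q, `|q - d| <= r ->
    tangent_cone S x q -> dot v (q - d) <= e / 3 * `|q - d|.
  have /nbhs_ballP[r /= r0 Hr] := Hv _ e3.
  exists (r / 2) => [|q qr]; first by rewrite divr_gt0.
  apply: Hr; rewrite -ball_normE /= distrC (le_lt_trans qr) //.
  by rewrite ltr_pdivrMr // ltr_pMr // ltr1n.
pose eta : R := Num.min 1 (r / (2 * e)).
have eta0 : 0 < eta by rewrite lt_min ltr01 divr_gt0 // mulr_gt0.
have eta1 : eta <= 1 by rewrite ge_min lexx.
have etar : eta * e <= r / 2.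
  apply: (@le_trans _ _ (r / (2 * e) * e)).
    by rewrite ler_pM2r // ge_min lexx orbT.
  by rewrite invfM mulrA divfK // gt_eqF.
pose a := d + eta *: v.
have ad : a - d = eta *: v by rewrite /a addrC addKr.
have appr (k : nat) : exists p : R * 'rV[R]_n, [/\ 0 < p.1 < k.+1%:R^-1,
     S (x + p.1 *: p.2), `|p.2 - d| <= r,
     forall q', S (x + p.1 *: q') -> `|q' - d| <= r ->
       dot (a - p.2) (a - p.2) <= dot (a - q') (a - q') &
     dot (a - p.2) (a - p.2) <= eta ^+ 2 * dot v v + k.+1%:R^-1].
  have k0 : 0 < k.+1%:R^-1 :> R by rewrite invr_gt0.
  have phid : dot (a - dk j) (a - dk j) @[j --> \oo] --> dot (a - d) (a - d).
    by apply: cvg_dot; apply: cvgB => //; exact: cvg_cst.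
  have : \forall j \near \oo, [/\ t j < k.+1%:R^-1, `|dk j - d| <= r &
      dot (a - dk j) (a - dk j) <= eta ^+ 2 * dot v v + k.+1%:R^-1].
    near=> j; split.
    - have := t0 j; near: j.
      move/cvgrPdist_lt : tcvg => /(_ _ k0); apply: filterS => j.
      by rewrite sub0r normrN => + tj; rewrite gtr0_norm.
    - near: j; move/cvgrPdist_le : dcvg => /(_ _ r0); apply: filterS => j.
      by rewrite distrC.
    - near: j; move/cvgrPdist_le : phid => /(_ _ k0); apply: filterS => j.
      rewrite ler_norml lerNl opprB => /andP[+ _].
      by rewrite lerBlDl ad dotZl dotZr mulrA -expr2.
  case=> N _ /(_ N (leqnn _)) [tN dN phiN].
  have tn0 : t N != 0 by rewrite gt_eqF.
  have [|y [Sy yr Hy]] := @closest_point S (x + t N *: a) (x + t N *: d) (t N * r) Scl.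
    exists (x + t N *: dk N) => //.
    by rewrite subr_ray normrZ gtr0_norm ?ler_pM2l.
  have ye : y = x + t N *: ((t N)^-1 *: (y - x)).
    by rewrite scalerA divff // scale1r addrC subrK.
  move: Sy yr Hy; rewrite ye; move: (_ *: (y - x)) => q Sq qr Hq {ye}.
  have scalea u : dot (x + t N *: a - (x + t N *: u)) (x + t N *: a - (x + t N *: u))
      = t N ^+ 2 * dot (a - u) (a - u).
    by rewrite subr_ray dotZl dotZr mulrA -expr2.
  have Hq' u : S (x + t N *: u) -> `|u - d| <= r ->
      dot (a - q) (a - q) <= dot (a - u) (a - u).
    move=> Su ur; rewrite -(ler_pM2l (exprn_gt0 2 (t0 N))) -!scalea; apply: Hq => //.
    by rewrite subr_ray normrZ gtr0_norm ?ler_pM2l.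
  exists (t N, q); split => //=.
  - by rewrite t0.
  - by move: qr; rewrite subr_ray normrZ gtr0_norm ?ler_pM2l.
  - exact: le_trans (Hq' _ (Sdk N) dN) phiN.
have [p Hp] := choice appr.
have [qb Hqb] : exists q, forall e N, 0 < e ->
    exists k, (N <= k)%N /\ `|(p k).2 - q| < e.
  apply: (@bounded_cluster _ _ (fun k => (p k).2) (r + `|d|)) => k.
  have [_ _ pr _ _] := Hp k.
  by rewrite -(subrK d (p k).2) (le_trans (ler_normD _ _)) // lerD2r.
have qbT : tangent_cone S x qb.
  apply: tangent_coneI => rho rho0.
  have [N _ HN] := near_infty_natSinv_lt (PosNum rho0).
  have [k [/HN/= Nk kq]] := Hqb _ N rho0.
  have [/andP[tk0 tk] Sk _ _ _] := Hp k.
  by exists (p k).1, (p k).2; rewrite tk0 (lt_trans tk) // ltW.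
have qbr : `|qb - d| <= r.
  apply/ler_addgt0Pr => rho rho0.
  have [k [_ kq]] := Hqb _ 0%N rho0.
  have [_ _ pr _ _] := Hp k.
  rewrite -(subrKA (p k).2) addrC (le_trans (ler_normD _ _)) // lerD //.
  by rewrite distrC ltW.
have Hvqb := Hr _ qbr qbT.
(* K collects the error made by replacing q by the cluster point qb and the
   value of the projection by its limit; rho K is made <= (eta e / 3)^2. *)
pose K := 2 * eta * (e / 3 + n%:R * `|v|) + 1.
have K0 : 0 < K by rewrite ltr_wpDl // !mulr_ge0 ?addr_ge0 ?(ltW e3) ?mulr_ge0 // ltW.
pose rho := Num.min e ((eta * (e / 3)) ^+ 2 / K).
have rho0 : 0 < rho by rewrite lt_min e0 divr_gt0 // exprn_gt0 // mulr_gt0.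
have [N _ HN] := near_infty_natSinv_lt (PosNum rho0).
have [k [/HN/= Nk kq]] := Hqb _ N rho0.
have [] := Hp k.
move: kq Nk; case: (p k) => s q /=; set c := k.+1%:R^-1 => kq crho /andP[s0 sc] Sq qr qmin qval.
have rhoe : rho <= e by rewrite ge_min lexx.
have Krho : rho * K <= (eta * (e / 3)) ^+ 2.
  by rewrite -ler_pdivlMr // ge_min lexx orbT.
have vz : dot v (q - d) <= e / 3 * `|q - d| + (e / 3 + n%:R * `|v|) * rho.
  have -> : dot v (q - d) = dot v (qb - d) + dot v (q - qb).
    by rewrite -dotDr [in RHS]addrC addrA subrK.
  apply: (@le_trans _ _ (e / 3 * (`|q - d| + rho) + n%:R * `|v| * rho)); last first.
    by rewrite mulrDr mulrDl addrA.
  apply: lerD.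
    apply: (le_trans Hvqb); rewrite ler_pM2l //.
    rewrite -(subrKA q) addrC (le_trans (ler_normD _ _)) // lerD2l distrC ltW //.
  by apply: (le_trans (dot_le _ _)); rewrite ler_wpM2l ?mulr_ge0 // ltW.
have zz : dot (q - d) (q - d) <= 2 * eta * dot v (q - d) + rho.
  move: qval; have -> : a - q = eta *: v - (q - d) by rewrite /a opprB addrA (addrC d).
  move: (q - d) => z; rewrite dotBl [dot (eta *: v) _]dotBr [dot z _]dotBr !dotZl !dotZr.
  rewrite (dotC z v); move: (dot v v) (dot z z) (dot v z) => vv zz v_z.
  by rewrite expr2; move=> H; lra.
have zle : `|q - d| <= eta * e.
  rewrite leNgt; apply/negP => zgt.
  have := sqr_norm_le_dot (q - d).
  move: zz vz zgt; move: (dot (q - d) (q - d)) (dot v (q - d)) `|q - d| => zz vz z h1 h2 h3 h4.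
  have h5 : vz * (2 * eta) <= (e / 3 * z + (e / 3 + n%:R * `|v|) * rho) * (2 * eta).
    by rewrite ler_wpM2r // mulr_ge0 // ltW.
  have h6 : z ^+ 2 <= 2 * eta * (e / 3) * z + (eta * (e / 3)) ^+ 2.
    apply: le_trans (lerD (lexx _) Krho).
    apply: (le_trans h4); apply: (le_trans h1); rewrite /K.
    by move: h5; move: (n%:R * `|v|) => m h5; nra.
  have h7 : 0 < eta * e by rewrite mulr_gt0.
  move: h6; set b := eta * e => h6.
  have : z ^+ 2 <= 2 * (b / 3) * z + (b / 3) ^+ 2.
    by apply: (le_trans h6); rewrite /b; lra.
  rewrite -/b in h3 h7; move=> h8; nra.
have aq : a - q = eta *: v - (q - d) by rewrite /a opprB addrA (addrC d).
exists s, (x + s *: q), (eta^-1 *: (a - q)); split.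
- by rewrite s0 (lt_trans sc) // (lt_le_trans crho).
- rewrite subr_ray normrZ gtr0_norm // mulrC ler_pM2r //.
  by rewrite (le_trans zle) // ler_piMl // ltW.
- have -> : eta^-1 *: (a - q) = (eta * s)^-1 *: ((x + s *: a) - (x + s *: q)).
    by rewrite subr_ray scalerA invfM mulfVK ?gt_eqF.
  apply: regular_normal_coneZ; first by rewrite invr_ge0 mulr_ge0 // ltW.
  apply: (@proximal_normal _ _ _ _ _ (s * (r / 2))) => //.
    by rewrite mulr_gt0 ?divr_gt0.
  move=> y Sy; have ye : y = x + s *: (s^-1 *: (y - x)).
    by rewrite scalerA divff ?gt_eqF // scale1r addrC subrK.
  move: Sy; rewrite ye; move: (_ *: (y - x)) => u Su {ye}.
  rewrite subr_ray normrZ gtr0_norm // ler_pM2l // => uq.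
  rewrite !subr_ray !dotZl !dotZr !mulrA -expr2.
  rewrite ler_pM2l ?exprn_gt0 //; apply: qmin => //.
  rewrite -(subrKA q) (le_trans (ler_normD _ _)) // (splitr r) lerD //.
  exact: le_trans zle etar.
- rewrite aq scalerBr scalerA mulVf ?gt_eqF // scale1r addrAC subrr add0r.
  by rewrite normrN normrZ gtr0_norm ?invr_gt0 // mulrC ler_pdivrMr // mulrC.
Unshelve. all: by end_near. Qed.

End Projection.

(** * Almost invariance along directions orthogonal to the normals *)

Section Shift.
Variables (R : realType) (n : nat).
Implicit Types (S : set 'rV[R]_n) (x d u v w q : 'rV[R]_n).

(** Minimize |p + tau w - q|^2 - ep^2 (1 + tau)^2 |w|^2 over q in S near p and
    tau in [0, 1].  If the minimum occurs at tau < 1, the first-order condition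
    in tau makes the proximal normal p + tau w - q far from orthogonal to w,
    against normal_almost_orthogonal; at tau = 1 the value of the minimum is the
    announced bound.  The shift 1 + tau keeps the derivative of the second term
    nonzero at tau = 0. *)
Lemma shift_almost_stays S x d (e : R) : closed S -> 0 < e ->
  exists2 del, 0 < del & forall t p w, 0 < t < del -> S p ->
    `|p - (x + t *: d)| <= del * t -> `|w| <= del * t ->
    (forall u, dir_normal_cone S x d u -> dot u w = 0) ->
    exists2 q, S q & `|p + w - q| <= e * `|w|.
Proof.
move=> Scl e0; pose M : R := n.+1%:R.
have M1 : 1 <= M by rewrite ler1n.
have nM : n%:R <= M by rewrite ler_nat.
pose ep := e / (2 * M).
have ep0 : 0 < ep by rewrite divr_gt0 // mulr_gt0 // (lt_le_trans ltr01).
have epM : 2 * ep * M = e by rewrite /ep invfM; field; rewrite gt_eqF // (lt_le_trans ltr01).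
have [|d1 d10 Hd1] := @normal_almost_orthogonal R n S x d (ep / 2); first by rewrite divr_gt0.
pose mu := Num.min 1 d1.
have mu0 : 0 < mu by rewrite lt_min ltr01.
have mu1 : mu <= 1 by rewrite ge_min lexx.
have mud : mu <= d1 by rewrite ge_min lexx orbT.
have C0 : 0 < 2 * (2 + e) by rewrite mulr_gt0 // addr_gt0.
pose del := mu / (2 * (2 + e)).
have del0 : 0 < del by rewrite divr_gt0.
have delC : del * (2 * (2 + e)) = mu by rewrite divfK // gt_eqF.
have delmu : del <= mu.
  by rewrite -delC ler_pMr //; lra.
exists del => // t p w /andP[t0 tdel] Sp pt wt wN.
have [->|w0] := eqVneq w 0.
  by exists p => //; rewrite addr0 subrr normr0 mulr0.
have tmu : t < mu by exact: lt_le_trans tdel delmu.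
have cK : compact ((S `&` [set q | `|q - p| <= 1]) `*` `[0 : R, 1]).
  by apply: compact_setX; [exact: compact_cball | exact: segment_compact].
pose F (z : 'rV[R]_n * R) :=
  dot (p + z.2 *: w - z.1) (p + z.2 *: w - z.1) - ep ^+ 2 * ((1 + z.2) * (1 + z.2)) * dot w w.
have cF : continuous F.
  move=> z; have H1 : p + y.2 *: w - y.1 @[y --> z] --> p + z.2 *: w - z.1.
    apply: (@cvgB R 'rV[R]_n); last exact: cvg_fst.
    apply: (@cvgD R 'rV[R]_n); first exact: cvg_cst.
    by apply: cvgZl; exact: cvg_snd.
  have H2 : 1 + y.2 @[y --> z] --> (1 + z.2 : R).
    by apply: cvgD; [exact: cvg_cst | exact: cvg_snd].
  have H3 : ep ^+ 2 * ((1 + y.2) * (1 + y.2)) * dot w w @[y --> z]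
      --> (ep ^+ 2 * ((1 + z.2) * (1 + z.2)) * dot w w : R).
    by apply: cvgMl; apply: cvgMr; apply: cvgM.
  apply: cvgB => //; exact: (@cvg_dot R n _ (nbhs z) _ _ _ _ _ H1 H1).
have [||[q tau]] := @compact_EVT_min _ R F _ _ cK.
- by exists (p, 0); rewrite /= subrr normr0 in_itv /= lexx ler01.
- exact: continuous_subspaceT.
rewrite inE /= in_itv /= => -[[Sq qp]] /andP[tau0 tau1] Hmin.
have {Hmin}Hmin q' tau' : S q' -> `|q' - p| <= 1 -> 0 <= tau' <= 1 -> F (q, tau) <= F (q',
    tau').
  by move=> Sq' q'p tau'01; apply: Hmin; rewrite inE /= in_itv.
pose v := p + tau *: w - q.
have W0 := dot_gt0 w0.
have vv_le : dot v v <= ep ^+ 2 * ((1 + tau) ^+ 2 - 1) * dot w w.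
  have := Hmin p 0 Sp; rewrite subrr normr0 ler01 lexx => /(_ isT isT).
  rewrite /F /= -!expr2 -/v scale0r addr0 subrr dot0l addr0 expr1n; move: (dot v v) (dot w
      w) => a b H; nra.
have tt3 : (1 + tau) ^+ 2 - 1 <= 3 by rewrite -subr_ge0; nra.
have v_le : `|v| <= e * `|w|.
  rewrite -(@ler_sqr R) ?nnegrE ?mulr_ge0 ?(ltW e0) //.
  apply: (le_trans (sqr_norm_le_dot v)); apply: (le_trans vv_le).
  apply: (@le_trans _ _ (ep ^+ 2 * 4 * (M * `|w| ^+ 2))).
    apply: (@le_trans _ _ (ep ^+ 2 * 4 * dot w w)).
      by rewrite ler_wpM2r ?dot_ge0 // ler_wpM2l ?sqr_ge0 // (le_trans tt3) // ler_nat.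
    apply: ler_wpM2l; first by rewrite mulr_ge0 ?sqr_ge0.
    apply: (le_trans (dot_le_sqr_norm w)).
    by rewrite ler_wpM2r ?sqr_ge0.
  have -> : (e * `|w|) ^+ 2 = ep ^+ 2 * 4 * (M ^+ 2 * `|w| ^+ 2) by rewrite -epM; ring.
  apply: ler_wpM2l; first by rewrite mulr_ge0 ?sqr_ge0.
  rewrite ler_wpM2r ?sqr_ge0 // expr2 ler_peMl // (le_trans ler01) //.
have [tau_1|] := eqVneq tau 1.
  by exists q => //; move: v_le; rewrite /v tau_1 scale1r.
move=> tau_n1; have {tau_n1} tau_lt1 : tau < 1 by rewrite lt_neqAle tau_n1.
exfalso.
have qpw : `|q - p| <= (1 + e) * `|w|.
  have -> : q - p = tau *: w - v by rewrite /v opprB [RHS]addrC opprD addrA subrK.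
  rewrite mulrDl mul1r (le_trans (ler_normB _ _)) // lerD //.
  by rewrite normrZ ger0_norm // ler_piMl.
have qp2 : `|q - p| <= 2^-1.
  have t1 : t <= 1 by exact: le_trans (ltW tmu) mu1.
  have h1 : (1 + e) * `|w| <= (2 + e) * (del * t) by rewrite ler_pM // ?addr_ge0 ?(ltW e0)
      // lerD2r ler1n.
  have h2 : (2 + e) * (del * t) = mu / 2 * t by rewrite -delC; field.
  apply: (le_trans qpw); apply: (le_trans h1); rewrite h2; nra.
have Nv : regular_normal_cone S q v.
  apply: (@proximal_normal _ _ _ _ _ 2^-1) => // q' Sq' q'q.
  have q'p : `|q' - p| <= 1.
    by rewrite -(subrKA q) (le_trans (ler_normD _ _)) // (splitr 1) lerD // mul1r.
  have := Hmin q' tau Sq' q'p; rewrite tau0 tau1 => /(_ isT).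
  by rewrite /F /= lerD2r.
have Hvw : dot v w <= ep / 2 * `|v| * `|w|.
  apply: (Hd1 t q) => //; first by rewrite t0 (lt_le_trans tmu).
  rewrite -(subrKA p) (le_trans (ler_normD _ _)) //.
  apply: (@le_trans _ _ ((1 + e) * (del * t) + del * t)).
    by rewrite lerD // (le_trans qpw) // ler_wpM2l // addr_ge0 // ltW.
  have -> : (1 + e) * (del * t) + del * t = mu / 2 * t by rewrite -delC; field.
  by rewrite ler_pM2r //; lra.
(* A one-sided step in tau; h <= ep^2 keeps the quadratic term
   below the gap left by the first-order condition. *)
pose h := Num.min (1 - tau) (ep ^+ 2).
have h0 : 0 < h by rewrite lt_min subr_gt0 tau_lt1 exprn_gt0.
have h1 : tau + h <= 1 by rewrite -lerBrDl ge_min lexx.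
have hep : h <= ep ^+ 2 by rewrite ge_min lexx orbT.
have th0 : 0 <= tau + h by rewrite addr_ge0 // ltW.
have := Hmin q (tau + h) Sq qp; rewrite h1 th0 => /(_ isT).
rewrite /F /= -!expr2.
have -> : p + (tau + h) *: w - q = v + h *: w by rewrite /v scalerDl addrA [LHS]addrAC.
rewrite -/v dotDl 2!dotDr !dotZl !dotZr (dotC w v).
have := sqr_norm_le_dot v; have := sqr_norm_le_dot w.
move: (dot v v) (dot v w) (dot w w) `|v| `|w| vv_le W0 Hvw => vv vw ww nv nw H1 H2 H3 H4 H5 H6.
have H7 : ep ^+ 2 * ww * (2 * (1 + tau) + h) <= 2 * vw + h * ww.
  rewrite -(ler_pM2l h0); nra.
have e20 : 0 < ep ^+ 2 by rewrite exprn_gt0.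
have H8 : ep * (nv * nw) <= 2^-1 * ((1 + tau) ^+ 2 * (ep ^+ 2 * ww)).
  have H9 : 0 <= (nv - ep * nw) ^+ 2 by rewrite sqr_ge0.
  have H10 : ep ^+ 2 * nw ^+ 2 <= ep ^+ 2 * ww by rewrite ler_pM2l.
  have H11 : 2 * (ep * (nv * nw)) <= nv ^+ 2 + ep ^+ 2 * nw ^+ 2 by nra.
  have H12 : nv ^+ 2 + ep ^+ 2 * nw ^+ 2 <= ep ^+ 2 * ((1 + tau) ^+ 2) * ww by nra.
  by lra.
have H9 : h * ww <= ep ^+ 2 * ww by rewrite ler_pM2r.
have H10 : 2 * vw <= ep * (nv * nw) by lra.
have E0 : 0 < ep ^+ 2 * ww by rewrite mulr_gt0.
have H11 : 0 <= ep ^+ 2 * ww * h by rewrite mulr_ge0 // ltW.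
move: (ep ^+ 2 * ww) E0 H7 H8 H9 H11 => E E0 H7 H8 H9 H11.
have H12 : E * (2 * (1 + tau)) <= E * (2^-1 * (1 + tau) ^+ 2 + 1) by lra.
by move: H12; rewrite ler_pM2l // => H12; nra.
Qed.

End Shift.

(** * Directional metric subregularity *)

Section Regularity.
Variables (R : realType) (n m : nat).

(** Strict differentiability at xb; it gives increments between any two nearby
    points, so derivatives of g away from xb never enter. *)
Definition strictly_diff (g : 'rV[R]_n -> 'rV[R]_m) xb (J : 'M[R]_(n, m)) : Prop :=
  forall e, 0 < e -> exists2 r, 0 < r & forall x x',
    `|x - xb| <= r -> `|x' - xb| <= r -> `|g x' - g x - (x' - x) *m J| <= e * `|x' - x|.

Variables (g : 'rV[R]_n -> 'rV[R]_m) (xb d : 'rV[R]_n) (J : 'M[R]_(n, m)).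
Variables (S : set 'rV[R]_m) (A : 'M[R]_(m, n)) (B : 'M[R]_m).
Hypotheses (g_cont : continuous g) (gJ : strictly_diff g xb J) (Scl : closed S).
Hypothesis AB : forall v : 'rV[R]_m, v = v *m A *m J + v *m B.
Hypothesis BN : forall u (v : 'rV[R]_m), dir_normal_cone S (g xb) (d *m J) u -> dot u (v *m
    B) = 0.

(** Proximal normals require the Euclidean norm, whereas the norm bars stand for
    the maximum norm. *)
Let enorm (v : 'rV[R]_m) : R := Num.sqrt (dot v v).

Lemma enorm_le (v : 'rV[R]_m) : enorm v <= m.+1%:R * `|v|.
Proof.
have -> : m.+1%:R * `|v| = Num.sqrt ((m.+1%:R * `|v|) ^+ 2).
  by rewrite sqrtr_sqr ger0_norm // mulr_ge0.
rewrite ler_wsqrtr // (le_trans (dot_le_sqr_norm v)) // exprMn ler_wpM2r ?sqr_ge0 //.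
by rewrite expr2 (le_trans _ (ler_peMl _ _)) ?ler_nat // ler1n.
Qed.

(** The residual a = g(x1) - q is a normal, so by normal_almost_orthogonal its
    component a B in W is nearly orthogonal to it and <a, (a A) J> is at least
    |a|^2 / 2.  Moving x1 against a A therefore decreases |g(x) - q| at a rate
    comparable to |a|, while the step has length O(|a|). *)
Lemma residual_slope : exists2 c, 0 < c & exists2 eta, 0 < eta &
  forall t q x1 rho, 0 < t < eta -> `|q - (g xb + t *: (d *m J))| <= eta * t ->
    `|x1 - xb| <= eta -> regular_normal_cone S q (g x1 - q) -> g x1 != q -> 0 < rho ->
    exists2 x2, `|x2 - x1| <= rho &
      enorm (g x2 - q) + c * `|x2 - x1| < enorm (g x1 - q).
Proof.
have [CA CA0 HA] := mulmx_bound A.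
have [CB CB0 HB] := mulmx_bound B.
have [CJ CJ0 HJ] := mulmx_bound J.
pose M : R := m.+1%:R.
have M0 : 0 < M by rewrite ltr0n.
pose ep := (8 * M * CA)^-1.
have ep0 : 0 < ep by rewrite invr_gt0 !mulr_gt0.
have epE : M * (ep * CA) = 8^-1.
  by rewrite /ep; field; rewrite !gt_eqF.
have [r r0 Hr] := gJ ep0.
have [|d1 d10 Hd1] := @normal_almost_orthogonal R m S (g xb) (d *m J) (2 * CB)^-1.
  by rewrite invr_gt0 mulr_gt0.
exists (16 * CA)^-1; first by rewrite invr_gt0 mulr_gt0.
exists (Num.min d1 (r / 2)) => [|t q x1 rho /andP[t0 td] qt x1b]; first by rewrite lt_min
    d10 divr_gt0.
have {}td : 0 < t < d1 by rewrite t0 (lt_le_trans td) // ge_min lexx.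
have {}qt : `|q - (g xb + t *: (d *m J))| <= d1 * t.
  by rewrite (le_trans qt) // ler_pM2r // ge_min lexx.
have {}x1b : `|x1 - xb| <= r / 2 by rewrite (le_trans x1b) // ge_min lexx orbT.
set a := g x1 - q => Na gnq rho0.
have a0 : a != 0 by rewrite subr_eq0.
have aB : dot a (a *m B) <= 2^-1 * dot a a.
  have := Hd1 t q a (a *m B) td qt Na (fun u => @BN u a).
  move=> /le_trans; apply.
  apply: (@le_trans _ _ ((2 * CB)^-1 * `|a| * (CB * `|a|))).
    by rewrite ler_wpM2l // mulr_ge0 // invr_ge0 mulr_ge0 // ltW.
  have -> : (2 * CB)^-1 * `|a| * (CB * `|a|) = 2^-1 * `|a| ^+ 2 by field; rewrite gt_eqF.
  by rewrite ler_wpM2l // sqr_norm_le_dot.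
pose h := a *m A.
have aJ : 2^-1 * dot a a <= dot a (h *m J).
  have : dot a a = dot a (h *m J) + dot a (a *m B) by rewrite -dotDr -AB.
  lra.
have na0 : 0 < enorm a by rewrite sqrtr_gt0 dot_gt0.
have na2 : enorm a ^+ 2 = dot a a by rewrite sqr_sqrtr // dot_ge0.
have a_na : `|a| <= enorm a by exact: norm_le_sqrt_dot.
have hle : `|h| <= CA * enorm a by rewrite (le_trans (HA a)) // ler_wpM2l // ltW.
pose C3 := M * ((CJ + ep) * CA) ^+ 2.
have C30 : 0 <= C3 by rewrite mulr_ge0 ?sqr_ge0 // ltW.
pose rh := Num.min rho (r / 2).
have rh0 : 0 < rh by rewrite lt_min rho0 divr_gt0.
have h1 : 0 < `|h| + 1 by rewrite ltr_wpDl.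
have C31 : 0 < 4 * (C3 + 1) by rewrite mulr_gt0 // ltr_wpDl.
have [s [s0 s1 sC3 sh]] : exists s, [/\ 0 < s, s <= 1, s * C3 <= 4^-1 & s * `|h| <= rh].
  exists (Num.min 1 (Num.min (4 * (C3 + 1))^-1 (rh / (`|h| + 1)))).
  set s := Num.min _ _.
  have s0 : 0 < s by rewrite !lt_min ltr01 invr_gt0 C31 divr_gt0.
  split => //; first by rewrite ge_min lexx.
    apply: (@le_trans _ _ ((4 * (C3 + 1))^-1 * (C3 + 1))).
      by rewrite ler_pM ?(ltW s0) ?lerDl // !ge_min lexx orbT.
    by rewrite invfM -mulrA mulVf ?mulr1 // gt_eqF // ltr_wpDl.
  apply: (@le_trans _ _ (rh / (`|h| + 1) * (`|h| + 1))).
    by rewrite ler_pM ?(ltW s0) ?lerDl // !ge_min lexx !orbT.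
  by rewrite divfK // gt_eqF.
pose x2 := x1 - s *: h.
have x21 : x2 - x1 = - (s *: h) by rewrite /x2 addrAC subrr add0r.
have nx21 : `|x2 - x1| = s * `|h| by rewrite x21 normrN normrZ gtr0_norm.
exists x2; first by rewrite nx21 (le_trans sh) // ge_min lexx.
have x1r : `|x1 - xb| <= r by rewrite (le_trans x1b) // ler_pdivrMr // ler_peMr ?ler1n // ltW.
have x2r : `|x2 - xb| <= r.
  rewrite -(subrKA x1) (le_trans (ler_normD _ _)) // nx21 (splitr r) lerD //.
  by rewrite (le_trans sh) // ge_min lexx orbT.
have Hstep := Hr x1 x2 x1r x2r.
set rr := (X in `|X| <= _) in Hstep.
have shle : s * `|h| <= s * (CA * enorm a) by rewrite ler_pM2l.
have rrle : `|rr| <= ep * (s * `|h|) by rewrite (le_trans Hstep) // nx21.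
pose b := - (s *: (h *m J)) + rr.
have gx2 : g x2 - q = a + b.
  have -> : b = g x2 - g x1 by rewrite /b /rr x21 mulNmx -scalemxAl opprK addrC addrK.
  by rewrite /a [RHS]addrC subrKA.
have ble : `|b| <= (CJ + ep) * CA * s * enorm a.
  rewrite (le_trans (ler_normD _ _)) // normrN normrZ gtr0_norm //.
  have sHJ : s * `|h *m J| <= s * (CJ * `|h|) by rewrite ler_wpM2l // ltW.
  have CJs : CJ * (s * `|h|) <= CJ * (s * (CA * enorm a)) by rewrite ler_wpM2l // ltW.
  have eps : ep * (s * `|h|) <= ep * (s * (CA * enorm a)) by rewrite ler_wpM2l // ltW.
  move: rrle sHJ CJs eps; clearbody rr; move: `|rr| `|h *m J| => u v *; lra.
have bb : dot b b <= s ^+ 2 * C3 * dot a a.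
  apply: (le_trans (dot_le_sqr_norm b)).
  apply: (@le_trans _ _ (M * ((CJ + ep) * CA * s * enorm a) ^+ 2)).
    by rewrite ler_pM ?sqr_ge0 ?ler_nat // ler_sqr ?nnegrE // (le_trans _ ble).
  by rewrite -na2 /C3 !exprMn le_eqVlt; apply/orP; left; apply/eqP; ring.
have arr : dot a rr <= s / 8 * dot a a.
  apply: (le_trans (dot_le _ _)).
  apply: (@le_trans _ _ (M * enorm a * (ep * (s * (CA * enorm a))))).
    rewrite ler_pM ?mulr_ge0 //; first by rewrite ler_pM ?ler_nat.
    by rewrite (le_trans rrle) // ler_wpM2l // ltW.
  have -> : M * enorm a * (ep * (s * (CA * enorm a))) = M * (ep * CA) * (s * enorm a ^+ 2)
      by ring.
  by rewrite epE na2 mulrA (mulrC _ s).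
have key : enorm (a + b) <= enorm a * (1 - s / 4).
  have s4 : 0 <= 1 - s / 4 by rewrite subr_ge0 ler_pdivrMr // mul1r (le_trans s1) // ler1n.
  rewrite -(@ler_sqr R) ?nnegrE ?sqrtr_ge0 ?mulr_ge0 ?sqrtr_ge0 //.
  rewrite sqr_sqrtr ?dot_ge0 // exprMn na2 dotDl 2!dotDr (dotC b a).
  have -> : dot a b = - (s * dot a (h *m J)) + dot a rr by rewrite dotDr dotNr dotZr.
  have aa0 := dot_ge0 a.
  have saJ : s * (2^-1 * dot a a) <= s * dot a (h *m J) by rewrite ler_wpM2l // ltW.
  have sbb : dot b b <= s * (4^-1 * dot a a).
    apply: (le_trans bb).
    have -> : s ^+ 2 * C3 * dot a a = s * (s * C3 * dot a a) by ring.
    by rewrite ler_wpM2l ?(ltW s0) // ler_wpM2r.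
  have ss : 0 <= s ^+ 2 * dot a a by rewrite mulr_ge0 ?sqr_ge0.
  move: saJ sbb arr ss; move: (dot a a) (dot b b) (dot a rr) (s * dot a (h *m J)) => aa'
      bb' ar sa.
  nra.
have cs : (16 * CA)^-1 * `|x2 - x1| <= s / 16 * enorm a.
  have -> : s / 16 * enorm a = (16 * CA)^-1 * (s * (CA * enorm a)) by field; rewrite gt_eqF.
  by rewrite nx21 ler_wpM2l // invr_ge0 mulr_ge0 // ltW.
rewrite gx2 (le_lt_trans (lerD key cs)) //.
have sna : 0 < s * enorm a by rewrite mulr_gt0.
move: sna; lra.
Qed.

(** Minimize |g(x1) - q| + c |x1 - x| over x1 near x and q in S near p, with c
    below the slope of the residual.  At a minimizer the residual is a proximal
    normal; were it nonzero, residual_slope would lower the value. *)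
Lemma metric_subregularity : exists2 K, 0 < K & exists2 eta, 0 < eta &
  forall t p x, 0 < t < eta -> S p -> `|p - (g xb + t *: (d *m J))| <= eta * t ->
    `|x - xb| <= eta -> `|g x - p| <= eta * t ->
    exists2 x', S (g x') & `|x' - x| <= K * `|g x - p|.
Proof.
have [c c0 [d1 d10 Hslope]] := residual_slope.
have [CJ CJ0 HJ] := mulmx_bound J.
have [r r0 Hr] := gJ ltr01.
pose M : R := m.+1%:R.
have M0 : 0 < M by rewrite ltr0n.
pose rho := Num.min 1 (r / 2).
have rho0 : 0 < rho by rewrite lt_min ltr01 divr_gt0.
have rho1 : rho <= 1 by rewrite ge_min lexx.
have rhor : rho <= r / 2 by rewrite ge_min lexx orbT.
pose mu := Num.min rho d1.
have mu0 : 0 < mu by rewrite lt_min rho0.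
have murho : mu <= rho by rewrite ge_min lexx.
have mud : mu <= d1 by rewrite ge_min lexx orbT.
(* C4 beta bounds all displacements of the minimizer from (x, p). *)
pose C4 := (1 + (CJ + 1)) / c + 2.
have C40 : 0 < C4 by rewrite addr_gt0 // divr_gt0 // !addr_gt0.
pose eta := mu / (2 * (M * C4 + 1)).
have D0 : 0 < 2 * (M * C4 + 1) by rewrite mulr_gt0 // addr_gt0 // mulr_gt0.
have eta0 : 0 < eta by rewrite divr_gt0.
have etaE : (M * C4 + 1) * eta = mu / 2.
  rewrite /eta; field; rewrite gt_eqF //; first by rewrite addr_gt0 // mulr_gt0.
have etamu : eta <= mu / 2.
  by rewrite -etaE ler_peMl ?(ltW eta0) // lerDr mulr_ge0 ?ltW.
exists (M / c); first by rewrite divr_gt0.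
exists eta => // t p x /andP[t0 teta] Sp pt xxb gxp.
pose beta := enorm (g x - p).
have beta_t : beta <= M * (eta * t).
  by rewrite (le_trans (enorm_le _)) // ler_wpM2l // ltW.
have beta0 : 0 <= beta by exact: sqrtr_ge0.
have C4beta : C4 * beta + eta * t <= mu / 2 * t.
  rewrite -etaE; move: beta_t C40; move: (beta) => b; nra.
pose F (z : 'rV[R]_n * 'rV[R]_m) := enorm (g z.1 - z.2) + c * `|z.1 - x|.
have cF : continuous F.
  move=> z; have H1 : g y.1 - y.2 @[y --> z] --> g z.1 - z.2.
    apply: (@cvgB R 'rV[R]_m); last exact: cvg_snd.
    by apply: (@continuous_cvg _ _ _ (nbhs z)); [exact: g_cont | exact: cvg_fst].
  have H2 : y.1 - x @[y --> z] --> z.1 - x.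
    by apply: (@cvgB R 'rV[R]_n); [exact: cvg_fst | exact: cvg_cst].
  have H3 : enorm (g y.1 - y.2) @[y --> z] --> (enorm (g z.1 - z.2) : R).
    have H4 : dot (g y.1 - y.2) (g y.1 - y.2) @[y --> z] --> dot (g z.1 - z.2) (g z.1 - z.2).
      exact: (@cvg_dot R m _ (nbhs z) _ _ _ _ _ H1 H1).
    exact: (@continuous_cvg _ _ _ (nbhs z) _ _ (@Num.sqrt R) _ (@sqrt_continuous R _) H4).
  apply: cvgD => //; apply: cvgMr; exact: (cvg_norm H2).
have cK : compact ([set u | `|u - x| <= rho] `*` (S `&` [set q | `|q - p| <= 1])).
  apply: compact_setX; last exact: compact_cball.
  by rewrite -[X in compact X]setTI; apply: compact_cball; exact: closedT.
have [||[x1 q]] := @compact_EVT_min _ R F _ _ cK.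
- by exists (x, p); rewrite /= !subrr !normr0 ltW.
- exact: continuous_subspaceT.
rewrite inE /= => -[x1x [Sq qp]] Hmin.
have {Hmin}Hmin x2 q2 : `|x2 - x| <= rho -> S q2 -> `|q2 - p| <= 1 -> F (x1, q) <= F (x2, q2).
  by move=> *; apply: Hmin; rewrite inE.
have Fb : F (x1, q) <= beta.
  by have := Hmin x p; rewrite !subrr !normr0 {2}/F /= subrr normr0 mulr0 addr0; apply =>
      //; rewrite ltW.
have x1b : c * `|x1 - x| <= beta by rewrite (le_trans _ Fb) // lerDr sqrtr_ge0.
have nb : enorm (g x1 - q) <= beta by rewrite (le_trans _ Fb) // lerDl mulr_ge0 // ltW.
have [gq|gnq] := eqVneq (g x1) q.
  exists x1; first by rewrite gq.
  rewrite mulrAC ler_pdivlMr // mulrC (le_trans x1b) //; exact: enorm_le.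
exfalso.
have bc0 : 0 <= beta / c by rewrite divr_ge0 // ltW.
have x1b' : `|x1 - x| <= beta / c by rewrite ler_pdivlMr // mulrC.
have t1 : t <= 1 by rewrite (le_trans (ltW teta)) // (le_trans etamu) // ler_pdivrMr //
    mul1r (le_trans murho) // (le_trans rho1) // ler1n.
have mut : mu / 2 * t <= mu / 2 by rewrite ler_piMr // divr_ge0 // ltW.
have etat0 : 0 < eta * t by rewrite mulr_gt0.
have C4E : C4 * beta = (1 + (CJ + 1)) * (beta / c) + 2 * beta.
  by rewrite /C4; field; rewrite gt_eqF.
have C4b : C4 * beta <= rho / 2.
  by move: C4beta etat0 mut murho; lra.
have bC4 : beta / c <= C4 * beta.
  have a1 : 0 <= (CJ + 1) * (beta / c) := mulr_ge0 (addr_ge0 (ltW CJ0) ler01) bc0.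
  have a2 : 0 <= 2 * beta by rewrite mulr_ge0.
  by rewrite C4E mulrDl mul1r -addrA lerDl addr_ge0.
have x1rho : `|x1 - x| <= rho / 2 by exact: le_trans x1b' (le_trans bC4 C4b).
have xr : `|x - xb| <= rho / 2.
  by rewrite (le_trans xxb) // (le_trans etamu) // ler_pM2r ?invr_gt0.
have x1xb : `|x1 - xb| <= mu.
  rewrite -(subrKA x) (le_trans (ler_normD _ _)) // (splitr mu) lerD //.
    apply: (le_trans x1b'); apply: (le_trans bC4).
    by move: C4beta etat0 mut; lra.
  exact: le_trans xxb etamu.
have rho_r : rho / 2 <= r.
  by move: rhor rho0; lra.
have mu_r : mu <= r.
  by move: rhor murho r0; lra.
have gx1 : `|g x1 - g x| <= (CJ + 1) * (beta / c).
  have -> : g x1 - g x = (x1 - x) *m J + (g x1 - g x - (x1 - x) *m J) by rewrite [RHS]addrC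
      subrK.
  rewrite (le_trans (ler_normD _ _)) // mulrDl mul1r lerD //.
    by rewrite (le_trans (HJ _)) // ler_wpM2l // ltW.
  rewrite (le_trans (Hr x x1 (le_trans xr rho_r) (le_trans x1xb mu_r))) //.
  by rewrite mul1r.
have qpb : `|q - p| <= C4 * beta.
  have -> : q - p = (g x - p) + ((g x1 - g x) - (g x1 - q)).
    by rewrite opprB [g x1 - g x + _]addrC subrKA [RHS]addrC subrKA.
  rewrite (le_trans (ler_normD _ _)) // C4E.
  have n1 := norm_le_sqrt_dot (g x1 - q); have n2 : `|g x - p| <= beta := norm_le_sqrt_dot _.
  have n3 := ler_normB (g x1 - g x) (g x1 - q).
  move: gx1 (le_trans n1 nb) n2 n3 bc0; move: (beta / c) (beta) (CJ + 1) => bc be cj; lra.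
have Na : regular_normal_cone S q (g x1 - q).
  apply: (@proximal_normal _ _ _ _ _ 2^-1) => // q' Sq' q'q.
  have q'p : `|q' - p| <= 1.
    rewrite -(subrKA q) (le_trans (ler_normD _ _)) // (splitr 1) lerD //; first by rewrite
        mul1r.
    by rewrite (le_trans qpb) // (le_trans C4b) // ler_pM2r ?invr_gt0.
  have := Hmin x1 q' x1x Sq' q'p; rewrite /F /= lerD2r.
  by rewrite /enorm ler_sqrt ?dot_ge0.
have td1 : 0 < t < d1.
  by rewrite t0 (lt_le_trans teta) // (le_trans etamu) // (le_trans _ mud) // ler_pdivrMr
      // ler_peMr ?ler1n // ltW.
have qt : `|q - (g xb + t *: (d *m J))| <= d1 * t.
  rewrite -(subrKA p) (le_trans (ler_normD _ _)) // (le_trans (lerD qpb pt)) //.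
  rewrite (le_trans C4beta) // ler_wpM2r // ?(ltW t0) // (le_trans _ mud) //.
  by rewrite ler_pdivrMr // ler_peMr ?ler1n // ltW.
have rho2 : 0 < rho / 2 by rewrite divr_gt0.
have [x2 x21 Hx2] := Hslope t q x1 (rho / 2) td1 qt (le_trans x1xb mud) Na gnq rho2.
have n21 : `|x2 - x| <= `|x2 - x1| + `|x1 - x| by rewrite -(subrKA x1) ler_normD.
have x2x : `|x2 - x| <= rho by rewrite (le_trans n21) // (splitr rho) lerD.
have := Hmin x2 q x2x Sq qp; rewrite /F /=.
have : c * `|x2 - x| <= c * (`|x2 - x1| + `|x1 - x|) by rewrite ler_pM2l.
move: Hx2; lra.
Qed.

End Regularity.

Section Correction.
Variables (R : realType) (n m : nat).
Variables (g : 'rV[R]_n -> 'rV[R]_m) (xb d : 'rV[R]_n) (J : 'M[R]_(n, m)).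
Variables (S : set 'rV[R]_m) (A : 'M[R]_(m, n)) (B : 'M[R]_m).
Hypotheses (g_cont : continuous g) (gJ : strictly_diff g xb J) (Scl : closed S).
Hypothesis AB : forall v : 'rV[R]_m, v = v *m A *m J + v *m B.
Hypothesis BN : forall u (v : 'rV[R]_m), dir_normal_cone S (g xb) (d *m J) u -> dot u (v *m
    B) = 0.

(** First move p by w inside S up to e |w|, then repair the remaining residual
    by metric subregularity. *)
Lemma feasible_correction : exists2 K, 0 < K & forall e, 0 < e ->
  exists2 del, 0 < del & forall t p x w, 0 < t < del -> S p ->
    `|p - (g xb + t *: (d *m J))| <= del * t -> `|x - (xb + t *: d)| <= del * t ->
    `|w| <= del * t ->
    (forall u, dir_normal_cone S (g xb) (d *m J) u -> dot u w = 0) ->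
    exists2 x', S (g x') & `|x' - x| <= K * (`|g x - p - w| + e * `|w|).
Proof.
have [K K0 [eta eta0 HK]] := metric_subregularity g_cont gJ Scl AB BN.
have [CJ CJ0 HJ] := mulmx_bound J.
exists K => // e e0.
have [d1 d10 Hd1] := shift_almost_stays (g xb) (d *m J) Scl e0.
have d0 : 0 < `|d| + 1 by rewrite ltr_wpDl.
have e30 : 0 < eta / (4 * (`|d| + 1)) by rewrite divr_gt0 // mulr_gt0.
have [r r0 Hr] := gJ e30.
pose C := CJ + e + `|d| + 3.
have C0 : 0 < C by rewrite addr_gt0 // ltr_wpDr // addr_gt0.
pose del := Num.min (Num.min 1 d1) (Num.min (eta / 2) r / C).
have del0 : 0 < del by rewrite !lt_min ltr01 d10 divr_gt0 // lt_min r0 divr_gt0.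
have del1 : del <= 1 by rewrite !ge_min lexx.
have deld : del <= d1 by rewrite !ge_min lexx orbT.
have delC : C * del <= Num.min (eta / 2) r by rewrite mulrC -ler_pdivlMr // ge_min lexx orbT.
have delCe : C * del <= eta / 2 by rewrite (le_trans delC) // ge_min lexx.
have delCr : C * del <= r by rewrite (le_trans delC) // ge_min lexx orbT.
exists del => // t p x w /andP[t0 tdel] Sp pt xt wt wN.
have delt : del * t <= d1 * t by rewrite ler_pM2r.
have [|||q Sq pwq] := Hd1 t p w _ Sp _ _ wN.
- by rewrite t0 (lt_le_trans tdel).
- exact: le_trans pt delt.
- exact: le_trans wt delt.
have t1 : t <= 1 by rewrite (le_trans (ltW tdel)).
have delt0 : 0 < del * t by rewrite mulr_gt0.
have ew : e * `|w| <= e * (del * t) by rewrite ler_pM2l.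
have deltt : del * t <= t by rewrite ler_piMl // ltW.
have xxb : `|x - xb| <= (`|d| + 1) * t.
  have -> : x - xb = (x - (xb + t *: d)) + t *: d by rewrite opprD addrA subrK.
  by rewrite (le_trans (ler_normD _ _)) // normrZ gtr0_norm // mulrDl mul1r addrC mulrC
      lerD // (le_trans xt).
have dC : (`|d| + 1) * t <= C * del.
  by rewrite ler_pM // ?(ltW d0) ?(ltW t0) ?(ltW tdel) // /C; lra.
have qt : `|q - (g xb + t *: (d *m J))| <= (e + 2) * (del * t).
  rewrite -(subrKA p) (le_trans (ler_normD _ _)) //.
  have -> : q - p = w - (p + w - q) by rewrite opprB addrCA (addrC p) opprD addNKr.
  have := ler_normB w (p + w - q).
  lra.
have Cdelt : C * del * t <= eta / 2 * t by rewrite ler_pM2r.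
have gxq : `|g x - q| <= eta * t.
  have -> : g x - q = (g x - g xb - (x - xb) *m J) + ((x - (xb + t *: d)) *m J
      - (q - (g xb + t *: (d *m J)))).
    have -> : (x - (xb + t *: d)) *m J = (x - xb) *m J - t *: (d *m J).
      by rewrite opprD addrA [LHS]mulmxBl -scalemxAl.
    move: (g x) (g xb) ((x - xb) *m J) (t *: (d *m J)) => G y a b.
    by apply/rowP => i; rewrite !mxE; ring.
  rewrite (le_trans (ler_normD _ _)) //.
  have H1 : `|g x - g xb - (x - xb) *m J| <= eta / 4 * t.
    rewrite (le_trans (Hr xb x _ _)) ?subrr ?normr0 ?(ltW r0) //.
      by rewrite (le_trans xxb) // (le_trans dC).
    apply: (le_trans (ler_wpM2l (ltW e30) xxb)).
    by rewrite le_eqVlt; apply/orP; left; apply/eqP; field; rewrite gt_eqF.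
  have H2 : `|(x - (xb + t *: d)) *m J| <= CJ * (del * t).
    by rewrite (le_trans (HJ _)) // ler_pM2l.
  have H3 := ler_normB ((x - (xb + t *: d)) *m J) (q - (g xb + t *: (d *m J))).
  have H4 : 0 <= `|d| * (del * t) by rewrite mulr_ge0 // ltW.
  move: Cdelt; rewrite /C => Cdelt.
  have H5 : 0 < eta * t by rewrite mulr_gt0.
  lra.
have Ct : (e + 2) * (del * t) <= C * del * t.
  rewrite mulrA ler_pM2r // ler_pM2r // /C -addrA; have : 0 <= `|d| by [].
  lra.
have teta : 0 < t < eta.
  rewrite t0 (lt_le_trans tdel) //.
  have : del <= C * del by rewrite ler_peMl ?(ltW del0) // /C; have : 0 <= `|d| by []; lra.
  lra.
have eta2 : eta / 2 <= eta by lra.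
have qeta : `|q - (g xb + t *: (d *m J))| <= eta * t.
  by rewrite (le_trans qt) // (le_trans Ct) // (le_trans Cdelt) // ler_pM2r.
have xeta : `|x - xb| <= eta by rewrite (le_trans xxb) // (le_trans dC) // (le_trans delCe).
have [x' Sx' x'x] := HK t q x teta Sq qeta xeta gxq.
exists x' => //; rewrite (le_trans x'x) // ler_pM2l //.
have -> : g x - q = (g x - p - w) + (p + w - q) by rewrite -(addrA (g x)) -opprD subrKA.
by rewrite (le_trans (ler_normD _ _)) // lerD2l.
Qed.

End Correction.

(** * Splitting by transversality *)

Section LinearAlgebra.
Variables (R : realType) (n m : nat).
Implicit Types (N : set 'rV[R]_m).

Lemma affine_hullZ N v a : N 0 -> affine_hull N v -> affine_hull N (a *: v).
Proof.
move=> N0 Nv V [aV NV]; rewrite -(addr0 (a *: v)) -(scaler0 _ (1 - a)).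
apply: (aV); [exact: (Nv V (conj aV NV)) | exact: NV].
Qed.

Lemma affine_hullD N u v : N 0 -> affine_hull N u -> affine_hull N v ->
  affine_hull N (u + v).
Proof.
move=> N0 Nu Nv.
have -> : u + v = 2 *: (2^-1 *: u + (1 - 2^-1) *: v).
  have -> : 1 - 2^-1 = 2^-1 :> R by field.
  by rewrite -scalerDr scalerA divff ?scale1r // pnatr_eq0.
apply: affine_hullZ => // V [aV NV]; apply: (aV); [exact: (Nu V (conj aV NV)) | exact: (Nv
    V (conj aV NV))].
Qed.

(** A matrix of maximal rank among those whose row space lies in the hull: a
    vector of N outside its row space would raise the rank. *)
Lemma affine_hull_basis N : N 0 -> exists P : 'M[R]_m,
  (forall v, (v <= P)%MS -> affine_hull N v) /\ (forall v, N v -> (v <= P)%MS).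
Proof.
move=> N0.
pose good k := `[< exists P : 'M[R]_m, (forall v : 'rV_m, (v <= P)%MS -> affine_hull N v)
    /\ \rank P = k >].
have ex : exists k, good k.
  exists 0%N; apply/asboolP; exists 0; split=> [v|]; last by rewrite mxrank0.
  by rewrite submx0 => /eqP -> V [_]; exact.
have bnd k : good k -> (k <= m)%N.
  by move=> /asboolP[P [_ <-]]; exact: rank_leq_row.
case: (ex_maxnP ex bnd) => k /asboolP[P [PN rP]] kmax.
exists P; split => // v Nv; apply: contrapT => /negP vP.
have : (\rank (P + v)%MS <= k)%N.
  apply: kmax; apply/asboolP; exists (P + v)%MS; split => // u /sub_addsmxP[[x y] /= ->].
  apply: affine_hullD => //; first by apply: PN; exact: submxMl.
  have -> : y *m v = (y 0 0) *: v.
    by rewrite {1}[y]mx11_scalar mul_scalar_mx.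
  by apply: affine_hullZ => // V [_]; apply.
rewrite leqNgt -rP => /negP; apply.
by rewrite -ltnS; apply: rank_ltmx; rewrite ltmxE addsmxSl addsmx_sub submx_refl /=.
Qed.

(** Transversality in dual form: a vector orthogonal to the rows of J and to the
    complement of the span of N lies in that span, hence is 0.  So the rows of J
    and of K, which span that complement, together span the space, and A and B are read
    off the blocks of a one-sided inverse of the stacked matrix. *)
Lemma transversal_splitting N (J : 'M[R]_(n, m)) : N 0 ->
  (forall l, l *m J^T = 0 -> affine_hull N l -> l = 0) ->
  exists (A : 'M[R]_(m, n)) (B : 'M[R]_m),
    [/\ forall v : 'rV[R]_m, v = v *m A *m J + v *m B,
      forall u (v : 'rV[R]_m), N u -> dot u (v *m B) = 0 &
      forall l, (forall w, (forall u, N u -> dot u w = 0) -> dot l w = 0) -> affine_hull N l].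
Proof.
move=> N0 nondeg.
have [P [PN NP]] := affine_hull_basis N0.
pose K := (cokermx P)^T.
have KN u (v : 'rV[R]_m) : N u -> dot u (v *m K) = 0.
  move=> /NP /submxP[D ->]; rewrite dot_mulmx /K trmxK -mulmxA mulmx_coker mulmx0.
  exact: dot0l.
have full : row_full (col_mx J K).
  rewrite -col_leq_rank -mxrank_tr row_leq_rank -kermx_eq0; apply/eqP/row_matrixP => i.
  rewrite row0; have : row i (kermx (col_mx J K)^T) *m (col_mx J K)^T = 0.
    by rewrite -row_mul mulmx_ker row0.
  rewrite tr_col_mx mul_mx_row -row_mx0 => /eq_row_mx[lJ lK].
  apply: nondeg => //; apply: PN; rewrite submxE.
  by move: lK; rewrite /K trmxK => ->.
have /row_fullP[X XQ] := full.
exists (lsubmx X), (rsubmx X *m K); split.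
- move=> v; rewrite -!mulmxA -mulmxDr -mul_row_col hsubmxK XQ mulmx1 //.
- by move=> u v Nu; rewrite mulmxA KN.
- move=> l Hl; apply: PN; rewrite submxE; apply/eqP.
  apply/rowP => j; rewrite [RHS]mxE -[LHS]dot_delta dotC dot_mulmx dotC.
  by apply: Hl => u Nu; exact: KN.
Qed.

End LinearAlgebra.

(** * First- and second-order expansions *)

Section Calculus.
Variables (R : realType) (n : nat).
Implicit Types (x d h v : 'rV[R]_n).

Lemma is_derive_line (F : 'rV[R]_n -> R^o) x h (s : R) :
  differentiable F (x + s *: h) ->
  is_derive s 1 (fun s => F (x + s *: h) : R^o) ('d F (x + s *: h) h).
Proof.
move=> dF; pose line (s : R) := x + s *: h.
have dline : is_diff s line (0 + ( *:%R ^~ h)) by exact: is_diffD.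
have dFl : is_diff (line s) F ('d F (line s)) by exact: differentiableP.
have dcomp := @is_diff_comp _ _ _ _ line _ F _ s dline dFl.
apply: DeriveDef; first by apply/derivable1_diffP; exact: ex_diff.
rewrite deriveE; last exact: ex_diff.
by rewrite (@diff_val _ _ _ _ _ _ _ dcomp) /= add0r scale1r.
Qed.

(** Mean value theorem on the segment; continuity of the partial derivatives
    along the basis vectors, of which there are finitely many, makes the
    derivative continuous as a linear map. *)
Lemma C1_strict (F : 'rV[R]_n -> R^o) xb : C1 F -> forall e, 0 < e ->
  exists2 r, 0 < r & forall x x', `|x - xb| <= r -> `|x' - xb| <= r ->
    `|F x' - F x - 'd F xb (x' - x)| <= e * `|x' - x|.
Proof.
move=> [dF cF] e e0.
have e'0 : 0 < e / n.+1%:R by rewrite divr_gt0.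
have : \forall y \near xb, forall j : 'I_n,
    `|'d F y (delta_mx 0 j) - 'd F xb (delta_mx 0 j)| <= e / n.+1%:R.
  near=> y; near: y; apply: filter_forall => j.
  have H := cF (delta_mx 0 j) xb.
  move/cvgrPdist_le : H => H.
  have {}H := H _ e'0.
  near=> y; rewrite distrC.
  near: y; exact: H.
move=> /nbhs_ballP[r /= r0 Hr].
exists (r / 2) => [|x x' xr x'r]; first by rewrite divr_gt0.
set h := x' - x.
have [|||c c01 Hc] := @MVT R (fun s => F (x + s *: h)) (fun s => 'd F (x + s *: h) h) 0 1.
- exact: ltr01.
- by move=> s _; apply: is_derive_line; exact: dF.
- apply: continuous_subspaceT => s.
  apply: (@differentiable_continuous _ _ _ s (fun s => F (x + s *: h) : R^o)).
  by apply/derivable1_diffP; exact: (@ex_derive _ _ _ _ _ _ _ (is_derive_line (dF _))).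
have xh : x + h = x' by rewrite /h addrC subrK.
move: Hc; rewrite scale1r xh scale0r addr0 subr0 mulr1 => ->.
move: c01; rewrite in_itv /= => /andP[c0 c1].
have yr : `|x + c *: h - xb| < r.
  have -> : x + c *: h - xb = (1 - c) *: (x - xb) + c *: (x' - xb).
    by rewrite /h; apply/rowP => i; rewrite !mxE; ring.
  rewrite (le_lt_trans (ler_normD _ _)) // !normrZ !gtr0_norm ?subr_gt0 //.
  apply: (@le_lt_trans _ _ (r / 2)); last by lra.
  have := ler_wpM2l (ltW c0) x'r.
  have c1' : 0 <= 1 - c by rewrite subr_ge0 ltW.
  have := ler_wpM2l c1' xr.
  lra.
clearbody h; have hE := row_sum_delta h.
have dE y : 'd F y h = \sum_j h 0 j * 'd F y (delta_mx 0 j).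
  by rewrite {1}hE linear_sum; apply: eq_bigr => j _; rewrite linearZ.
have E : 'd F (x + c *: h) h - 'd F xb h =
    \sum_j h 0 j * ('d F (x + c *: h) (delta_mx 0 j) - 'd F xb (delta_mx 0 j)).
  transitivity (\sum_j h 0 j * 'd F (x + c *: h) (delta_mx 0 j)
                - \sum_j h 0 j * 'd F xb (delta_mx 0 j)).
    exact: (congr2 (fun a b : R => a - b) (dE _) (dE _)).
  by rewrite -sumrB; apply: eq_bigr => j _; rewrite mulrBr.
have {}E : `|'d F (x + c *: h) h - 'd F xb h| <= `|\sum_j h 0 j * ('d F (x + c *: h)
    (delta_mx 0 j) - 'd F xb (delta_mx 0 j))|.
  by rewrite E.
apply: (le_trans E).
apply: (le_trans (ler_norm_sum _ _ _)).
apply: (@le_trans _ _ (\sum_(j < n) (`|h| * (e / n.+1%:R)))).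
  apply: ler_sum => j _; rewrite normrM ler_pM ?normr_coord //.
  by apply: Hr; rewrite -ball_normE /= distrC.
rewrite sumr_const card_ord -[leLHS]mulr_natl mulrCA mulrC ler_wpM2r //.
by rewrite mulrCA ler_piMr ?(ltW e0) // ler_pdivrMr // mul1r ler_nat.
Unshelve. all: by end_near. Qed.

Lemma C2_C1 (V : normedModType R) (F : 'rV[R]_n -> V) : C2 F -> C1 F.
Proof.
move=> [dF d2F]; split => // v x.
by apply: differentiable_continuous; case: (d2F v) => + _; apply.
Qed.

End Calculus.

Section Taylor.
Variables (R : realType) (n : nat).
Implicit Types (x d h v : 'rV[R]_n).

Lemma C1_ray (G : 'rV[R]_n -> R^o) xb d : C1 G -> forall e, 0 < e ->
  exists2 r, 0 < r & forall c : R, 0 < c < r ->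
    `|G (xb + c *: d) - G xb - c * 'd G xb d| <= e * c.
Proof.
move=> C1G e e0; have d0 : 0 < `|d| + 1 by rewrite ltr_wpDl.
have e'0 : 0 < e / (`|d| + 1) by rewrite divr_gt0.
have [r r0 Hr] := @C1_strict R n G xb C1G _ e'0.
exists (r / (`|d| + 1)) => [|c /andP[c0 cr]]; first by rewrite divr_gt0.
have xc : xb + c *: d - xb = c *: d by rewrite addrC addKr.
have cd : `|c *: d| <= c * (`|d| + 1).
  by rewrite normrZ gtr0_norm // ler_pM2l // lerDl.
have xr : `|xb - xb| <= r by rewrite subrr normr0 ltW.
have xcr : `|xb + c *: d - xb| <= r.
  by rewrite xc (le_trans cd) // -ler_pdivlMr // ltW.
have := Hr xb (xb + c *: d) xr xcr.
have -> : 'd G xb (xb + c *: d - xb) = c * 'd G xb d.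
  by rewrite xc; exact: linearZ.
move/le_trans; apply.
have -> : e * c = e / (`|d| + 1) * (c * (`|d| + 1)) by field; rewrite gt_eqF.
by rewrite ler_wpM2l ?(ltW e'0) // xc.
Qed.

(** The mean value theorem applied to the remainder, whose derivative is o(s) by
    differentiability of the directional derivative G.  The values at xb are
    parameters fixed by equations, so that the coordinates of a vector map can
    be substituted for them. *)
Lemma C2_Taylor (F G : 'rV[R]_n -> R^o) xb d (a b : R) : C2 F ->
  (fun x => 'd F x d) = G -> G xb = a -> 'd G xb d = b -> forall e, 0 < e ->
  exists2 r, 0 < r & forall t, 0 < t < r ->
    `|F (xb + t *: d) - F xb - t * a - 2^-1 * t ^+ 2 * b| <= e * t ^+ 2.
Proof.
move=> [dF d2F] FG Ga Gb e e0.
have C1G : C1 G by rewrite -FG; exact: d2F.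
have [r r0 Hr] := @C1_ray G xb d C1G _ e0.
rewrite Ga Gb in Hr.
exists r => // t /andP[t0 tr].
pose psi (s : R) : R^o := F (xb + s *: d) - s * a - 2^-1 * s ^+ 2 * b.
have dpsi (s : R) : is_derive s (1 : R) psi (G (xb + s *: d) - a - s * b).
  have H := is_derive_line (dF (xb + s *: d)).
  have {}H : is_derive s (1 : R) (fun s => F (xb + s *: d) : R^o) (G (xb + s *: d)).
    by rewrite -FG.
  have -> : psi = (fun s => F (xb + s *: d) : R^o) - (a *: (id : R -> R^o))
      - ((2^-1 * b) *: ((id : R -> R^o) ^+ 2)).
    apply/funext => u; rewrite /psi !fctE /=.
    congr (_ - _ - _); first exact: mulrC.
    rewrite -[RHS]/(2^-1 * b * u ^+ 2); ring.
  apply: is_derive_eq.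
  rewrite /= expr1 /GRing.scale /= !mulr1.
  by congr (_ - _); field.
have [|c c01 Hc] := @MVT R psi (fun s => G (xb + s *: d) - a - s * b) 0 t t0 (fun s _ =>
    dpsi s).
  apply: continuous_subspaceT => s.
  apply: (@differentiable_continuous _ _ _ s psi).
  by apply/derivable1_diffP; exact: (@ex_derive _ _ _ _ _ _ _ (dpsi s)).
move: c01; rewrite in_itv /= => /andP[c0 ct].
have cr : 0 < c < r by rewrite c0 (lt_trans ct).
have H := Hr c cr.
have psi0 : psi 0 = F xb.
  by rewrite /psi scale0r addr0 mul0r expr0n /= mulr0 mul0r !subr0.
have psit : F (xb + t *: d) - F xb - t * a - 2^-1 * t ^+ 2 * b = psi t - psi 0.
  by rewrite psi0 /psi; move: (F _) (F _) => u v; ring.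
rewrite psit Hc subr0 normrM (gtr0_norm t0) expr2 mulrA ler_wpM2r ?(ltW t0) //.
by apply: (le_trans H); rewrite ler_wpM2l ?(ltW e0) // ltW.
Qed.

End Taylor.

Section Components.
Variables (R : realType) (n m : nat).
Implicit Types (x d h v : 'rV[R]_n) (l : 'rV[R]_m).

Lemma is_diff_dot (F : 'rV[R]_n -> 'rV[R]_m) x l :
  differentiable F x ->
  is_diff x (fun y => dot (F y) l : R^o) (fun v => dot ('d F x v) l : R^o).
Proof.
move=> dF; pose phi (v : 'rV[R]_m) : R^o := dot v l.
have phil : linear phi by move=> a u v; rewrite /phi dotDl dotZl.
pose phiM := GRing.isLinear.Build _ _ _ _ _ phil.
pose phiL : {linear 'rV[R]_m -> R^o} := HB.pack phi phiM.
have phic : continuous phiL.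
  move=> v; exact: (@cvg_dot R m _ (nbhs v) _ id (cst l) v l cvg_id (cvg_cst l)).
have dphi : is_diff (F x) (phiL : 'rV[R]_m -> R^o) (phiL : 'rV[R]_m -> R^o).
  by apply: DiffDef; [exact: linear_differentiable | exact: diff_lin].
have dFx : is_diff x F ('d F x) by exact: differentiableP.
exact: (@is_diff_comp _ _ _ _ F _ phiL _ x dFx dphi).
Qed.

Lemma diff_dot (F : 'rV[R]_n -> 'rV[R]_m) x l v : differentiable F x ->
  'd (fun y => dot (F y) l : R^o) x v = dot ('d F x v) l.
Proof. by move=> dF; have D := is_diff_dot l dF; rewrite (@diff_val _ _ _ _ _ _ _ D). Qed.

Lemma C1_dot (F : 'rV[R]_n -> 'rV[R]_m) l :
  C1 F -> C1 (fun y => dot (F y) l : R^o).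
Proof.
move=> [dF cF]; split=> [x|v x].
  by have D := is_diff_dot l (dF x); exact: ex_diff.
have -> : (fun y => 'd (fun y => dot (F y) l : R^o) y v) = (fun y => dot ('d F y v) l).
  by apply/funext => y; rewrite diff_dot.
exact: (@cvg_dot R m _ (nbhs x) _ _ (cst l) _ l (cF v x) (cvg_cst l)).
Qed.

Lemma C2_dot (F : 'rV[R]_n -> 'rV[R]_m) l :
  C2 F -> C2 (fun y => dot (F y) l : R^o).
Proof.
move=> [dF d2F]; split=> [x|v].
  by have D := is_diff_dot l (dF x); exact: ex_diff.
have -> : (fun y => 'd (fun y => dot (F y) l : R^o) y v) = (fun y => dot ('d F y v) l).
  by apply/funext => y; rewrite diff_dot.
exact: C1_dot.
Qed.

Lemma diff_add (W : normedModType R) (F G : 'rV[R]_n -> W) x v :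
  differentiable F x -> differentiable G x ->
  'd (fun y => F y + G y) x v = 'd F x v + 'd G x v.
Proof. by move=> dF dG; rewrite [LHS](congr1 (fun k => k v) (diffD dF dG)). Qed.

Lemma C1_add (W : normedModType R) (F G : 'rV[R]_n -> W) :
  C1 F -> C1 G -> C1 (fun y => F y + G y).
Proof.
move=> [dF cF] [dG cG]; split=> [x|v x]; first exact: differentiableD.
have -> : (fun y => 'd (fun y => F y + G y) y v) = (fun y => 'd F y v + 'd G y v).
  by apply/funext => y; exact: diff_add.
exact: cvgD (cF v x) (cG v x).
Qed.

Lemma C2_add (W : normedModType R) (F G : 'rV[R]_n -> W) :
  C2 F -> C2 G -> C2 (fun y => F y + G y).
Proof.
move=> [dF cF] [dG cG]; split=> [x|v]; first exact: differentiableD.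
have -> : (fun y => 'd (fun y => F y + G y) y v) = (fun y => 'd F y v + 'd G y v).
  by apply/funext => y; exact: diff_add.
exact: C1_add.
Qed.

(** Used to pass from finitely many coordinates to the vector. *)
Lemma common_radius (P : 'I_m -> R -> Prop) :
  (forall i r r', 0 < r' <= r -> P i r -> P i r') ->
  (forall i, exists2 r, 0 < r & P i r) ->
  exists2 r, 0 < r & forall i, P i r.
Proof.
move=> mono ex.
have [r Hr] := choice (fun i => let: ex_intro2 r r0 Pr := ex i in ex_intro _ r (conj r0 Pr)).
exists (\big[Num.min/1]_(i < m) r i) => [|i].
  by rewrite lt_bigmin // => i _; case: (Hr i).
apply: (mono i (r i)); last by case: (Hr i).
by rewrite lt_bigmin ?bigmin_le_id //=; [exact: bigmin_le | move=> j _; case: (Hr j)].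
Qed.

Lemma dJ_diff (g : 'rV[R]_n -> 'rV[R]_m) x v : v *m 'J g x = 'd g x v.
Proof. by rewrite /jacobian mul_rV_lin1. Qed.

Lemma C1_strictly_diff (g : 'rV[R]_n -> 'rV[R]_m) xb :
  C1 g -> strictly_diff g xb ('J g xb).
Proof.
move=> C1g e e0; have [dg _] := C1g.
have [i r r' /andP[r'0 r'r] H x x' xr x'r|i|r r0 Hr] := @common_radius (fun i r => forall x
    x' : 'rV[R]_n,
    `|x - xb| <= r -> `|x' - xb| <= r ->
    `|g x' 0 i - g x 0 i - 'd g xb (x' - x) 0 i| <= e * `|x' - x|).
- by apply: H; [exact: le_trans xr r'r | exact: le_trans x'r r'r].
- have [r r0 Hr] := C1_strict xb (C1_dot (delta_mx 0 i) C1g) e0.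
  exists r => // x x' xr x'r; have := Hr x x' xr x'r.
  by rewrite diff_dot // !dot_delta.
exists r => // x x' xr x'r; apply: rV_norm_le => [|i]; first by rewrite mulr_ge0 // ltW.
by rewrite dJ_diff !mxE; exact: Hr.
Qed.

Lemma C2_Taylor_vec (g : 'rV[R]_n -> 'rV[R]_m) xb d : C2 g -> forall e, 0 < e ->
  exists2 r, 0 < r & forall t, 0 < t < r ->
    `|g (xb + t *: d) - g xb - t *: (d *m 'J g xb)
       - (2^-1 * t ^+ 2) *: 'd (fun x => 'd g x d) xb d| <= e * t ^+ 2.
Proof.
move=> C2g e e0; have [dg d2g] := C2g.
have [D DE] : exists D, d *m 'J g xb = D by eexists.
have [W WE] : exists W, 'd (fun x => 'd g x d) xb d = W by eexists.
rewrite DE WE.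
have [i r r' /andP[r'0 r'r] H t /andP[t0 tr]|i|r r0 Hr] := @common_radius (fun i r =>
    forall t, 0 < t < r ->
    `|g (xb + t *: d) 0 i - g xb 0 i - t * D 0 i - 2^-1 * t ^+ 2 * W 0 i| <= e * t ^+ 2).
- by apply: H; rewrite t0 (lt_le_trans tr).
- have FG : (fun x => 'd (fun y => dot (g y) (delta_mx 0 i) : R^o) x d)
      = (fun x => dot ('d g x d) (delta_mx 0 i) : R^o).
    by apply/funext => x; rewrite diff_dot.
  have Ga : (fun x => dot ('d g x d) (delta_mx 0 i) : R^o) xb = D 0 i.
    by rewrite -DE dJ_diff; exact: dot_delta.
  have Gb : 'd (fun x => dot ('d g x d) (delta_mx 0 i) : R^o) xb d
      = W 0 i.
    rewrite -WE; exact: etrans (diff_dot _ _ ((d2g d).1 xb)) (dot_delta _ _).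
  have [r r0 Hr] := C2_Taylor (C2_dot (delta_mx 0 i) C2g) FG Ga Gb e0.
  exists r => // t tr; have := Hr t tr.
  by rewrite (dot_delta (g (xb + t *: d)) i) (dot_delta (g xb) i).
exists r => // t tr; apply: rV_norm_le => [|i]; first by rewrite mulr_ge0 ?sqr_ge0 // ltW.
by have := Hr i t tr; rewrite !mxE.
Qed.

Lemma C2_continuous (W : normedModType R) (F : 'rV[R]_n -> W) : C2 F -> continuous F.
Proof. by move=> [dF _] x; exact: differentiable_continuous. Qed.

End Components.

Section Gradient.
Variables (R : realType) (n m : nat).
Implicit Types (x d v : 'rV[R]_n) (l : 'rV[R]_m).

Lemma dot_gradient (F : 'rV[R]_n -> R^o) x v : dot (gradient F x) v = 'd F x v.
Proof.
rewrite {2}(row_sum_delta v) linear_sum dotE; apply: eq_bigr => j _.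
by rewrite mxE linearZ /= mulrC.
Qed.

Lemma dot_hessian (F : 'rV[R]_n -> R^o) x d : C2 F ->
  dot d (d *m hessian F x) = 'd (fun y => 'd F y d) x d.
Proof.
move=> [dF d2F]; rewrite /hessian dJ_diff dotC.
have dG : differentiable (gradient F) x.
  have -> : gradient F = \sum_(j < n) (fun y => ('d F y (delta_mx 0 j) : R) *: (delta_mx 0
      j : 'rV[R]_n)).
    apply/funext => y; rewrite [LHS]row_sum_delta fct_sumE; apply: eq_bigr => j _.
    by rewrite mxE.
  apply: differentiable_sum => j; apply: differentiableZl; exact: ((d2F _).1 x).
have E : (fun y => dot (gradient F y) d : R^o) = (fun y => 'd F y d).
  by apply/funext => y; exact: dot_gradient.
transitivity ('d (fun y => dot (gradient F y) d : R^o) x d).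
  exact: esym (diff_dot d d dG).
exact: (congr1 (fun G : 'rV[R]_n -> R^o => 'd G x d) E).
Qed.

Lemma gradient_lagrangian (f : 'rV[R]_n -> R^o) (g : 'rV[R]_n -> 'rV[R]_m) x l :
  differentiable f x -> differentiable g x ->
  gradient (lagrangian f g l) x = gradient f x + l *m ('J g x)^T.
Proof.
move=> df dg; have D := is_diff_dot l dg.
have key v : 'd (lagrangian f g l) x v = dot (gradient f x + l *m ('J g x)^T) v.
  transitivity ('d f x v + 'd (fun y => dot (g y) l : R^o) x v).
    exact: (diff_add _ df (@ex_diff _ _ _ _ _ _ _ D)).
  rewrite dotDl dot_gradient; congr (_ + _).
  by rewrite -dot_mulmx dJ_diff dotC; exact: diff_dot.
by apply/rowP => j; rewrite mxE key dot_delta.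
Qed.

Lemma hessian_lagrangian (f : 'rV[R]_n -> R^o) (g : 'rV[R]_n -> 'rV[R]_m) x d l :
  C2 f -> C2 g -> dot d (d *m hessian (lagrangian f g l) x) =
    'd (fun y => 'd f y d) x d + dot ('d (fun y => 'd g y d) x d) l.
Proof.
move=> C2f C2g; have [df d2f] := C2f; have [dg d2g] := C2g.
have C2L : C2 (lagrangian f g l) := C2_add C2f (C2_dot l C2g).
transitivity ('d (fun y => 'd (lagrangian f g l) y d) x d); first exact: dot_hessian.
have E : (fun y => 'd (lagrangian f g l) y d : R^o) = (fun y => 'd f y d + dot ('d g y d) l).
  apply/funext => y; have D := is_diff_dot l (dg y).
  transitivity ('d f y d + 'd (fun y => dot (g y) l : R^o) y d).
    exact: (diff_add _ (df y) (@ex_diff _ _ _ _ _ _ _ D)).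
  by congr (_ + _); exact: diff_dot.
transitivity ('d (fun y => 'd f y d + dot ('d g y d) l : R^o) x d).
  exact: (congr1 (fun F : 'rV[R]_n -> R^o => 'd F x d) E).
have D := is_diff_dot l ((d2g d).1 x).
transitivity ('d (fun y => 'd f y d : R^o) x d + 'd (fun y => dot ('d g y d) l : R^o) x d).
  exact: (diff_add _ ((d2f d).1 x) (@ex_diff _ _ _ _ _ _ _ D)).
by congr (_ + _); apply: diff_dot; exact: ((d2g d).1 x).
Qed.

End Gradient.

(** * Optimality conditions at a local minimizer *)

Section Optimality.
Variables (R : realType) (n m : nat).
Variables (f : 'rV[R]_n -> R) (g : 'rV[R]_n -> 'rV[R]_m) (S : set 'rV[R]_m).
Variables (xb d gf : 'rV[R]_n) (J : 'M[R]_(n, m)) (A : 'M[R]_(m, n)) (B : 'M[R]_m).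
Hypotheses (g_cont : continuous g) (gJ : strictly_diff g xb J) (Scl : closed S).
Hypothesis AB : forall v : 'rV[R]_m, v = v *m A *m J + v *m B.
Hypothesis BN : forall u (v : 'rV[R]_m), dir_normal_cone S (g xb) (d *m J) u -> dot u (v *m
    B) = 0.
Hypothesis f_strict : forall e, 0 < e -> exists2 r, 0 < r & forall x x',
  `|x - xb| <= r -> `|x' - xb| <= r -> `|f x' - f x - dot gf (x' - x)| <= e * `|x' - x|.
Hypothesis f_min : exists2 r, 0 < r & forall x, `|x - xb| <= r -> S (g x) -> f xb <= f x.

Let orthN (w : 'rV[R]_m) := forall u, dir_normal_cone S (g xb) (d *m J) u -> dot u w = 0.

(** The corrected feasible point x' has f(x') >= f(xb), and f(x') - f(x) is
    O(|x' - x|).  The bound on |g x - p - w| by del keeps x' in the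
    neighbourhood where xb is optimal. *)
Lemma exact_penalty : exists2 K, 0 < K & forall e, 0 < e ->
  exists2 del, 0 < del & forall t p x w, 0 < t < del -> S p ->
    `|p - (g xb + t *: (d *m J))| <= del * t -> `|x - (xb + t *: d)| <= del * t ->
    `|w| <= del * t -> orthN w -> `|g x - p - w| <= del ->
    f xb <= f x + K * (`|g x - p - w| + e * `|w|).
Proof.
have [K K0 HK] := feasible_correction g_cont gJ Scl AB BN.
have [r1 r10 Hr1] := f_strict ltr01.
have [r2 r20 Hr2] := f_min.
pose Cf := n%:R * `|gf| + 1.
have Cf0 : 0 < Cf by rewrite ltr_wpDl // mulr_ge0.
exists (Cf * K) => [|e e0]; first by rewrite mulr_gt0.
have [d1 d10 Hd1] := HK e e0.
pose r := Num.min r1 r2.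
have r0 : 0 < r by rewrite lt_min r10.
pose C := (`|d| + 1) + K * (1 + e).
have C0 : 0 < C by rewrite addr_gt0 ?ltr_wpDl // mulr_gt0 // addr_gt0.
pose del := Num.min (Num.min 1 d1) (r / C).
have del0 : 0 < del by rewrite !lt_min ltr01 d10 divr_gt0.
have del1 : del <= 1 by rewrite !ge_min lexx.
have deld : del <= d1 by rewrite !ge_min lexx orbT.
have delC : C * del <= r by rewrite mulrC -ler_pdivlMr // ge_min lexx orbT.
exists del => // t p x w /andP[t0 tdel] Sp pt xt wt wN gpw.
have delt : del * t <= d1 * t by rewrite ler_pM2r.
have tt : 0 < t < d1 by rewrite t0 (lt_le_trans tdel).
have [x' Sx' x'x] := Hd1 t p x w tt Sp (le_trans pt delt) (le_trans xt delt) (le_trans wt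
    delt) wN.
have t1 : t <= 1 by rewrite (le_trans (ltW tdel)).
have xxb : `|x - xb| <= (`|d| + 1) * del.
  have -> : x - xb = (x - (xb + t *: d)) + t *: d by rewrite opprD addrA subrK.
  rewrite (le_trans (ler_normD _ _)) // normrZ gtr0_norm // mulrDl mul1r addrC lerD //.
    by rewrite mulrC ler_wpM2l // ltW.
  by rewrite (le_trans xt) // ler_piMr // ltW.
have x'x2 : `|x' - x| <= K * (1 + e) * del.
  rewrite (le_trans x'x) // -mulrA ler_pM2l // mulrDl mul1r lerD // ler_pM2l //.
  by rewrite (le_trans wt) // ler_piMr // ltW.
have xr : `|x - xb| <= r.
  rewrite (le_trans xxb) // (le_trans _ delC) // ler_pM2r // lerDl mulr_ge0 ?ltW //.
  by rewrite addr_gt0.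
have x'r : `|x' - xb| <= r.
  rewrite -(subrKA x) (le_trans (ler_normD _ _)) // (le_trans (lerD x'x2 xxb)) //.
  by rewrite (le_trans _ delC) // [leRHS]mulrDl addrC.
have rr1 : r <= r1 by rewrite ge_min lexx.
have rr2 : r <= r2 by rewrite ge_min lexx orbT.
have H1 := Hr2 x' (le_trans x'r rr2) Sx'.
have H2 := Hr1 x x' (le_trans xr rr1) (le_trans x'r rr1).
have H3 := dot_le gf (x' - x).
have H4 : Cf * `|x' - x| <= Cf * K * (`|g x - p - w| + e * `|w|).
  by rewrite -mulrA ler_pM2l.
apply: (le_trans H1); apply: le_trans (lerD (lexx _) H4).
move: H2; rewrite ler_norml => /andP[_]; rewrite /Cf; lra.
Qed.

(** Exact penalty at x = xb + t (d + u), p = y + t q with q close to v, and shift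
    - t w: the residual is o(t) because (d + u) J + w = v. *)
Lemma first_order_growth e : 0 < e -> exists2 rho, 0 < rho & forall v u w,
  tangent_cone S (g xb) v -> `|v - d *m J| <= rho -> `|u| <= rho -> `|w| <= rho ->
  orthN w -> v = d *m J + u *m J + w -> - (e * `|w|) <= dot gf (d + u).
Proof.
move=> e0; have [K K0 HK] := exact_penalty.
have e'0 : 0 < e / K by rewrite divr_gt0.
have [del del0 Hdel] := HK _ e'0.
exists (del / 2) => [|v u w Tv vd ud wd wN vE]; first by rewrite divr_gt0.
rewrite lerNl; apply/ler_addgt0Pr => eta eta0.
pose D := `|d + u|.
have D0 : 0 <= D by exact: normr_ge0.
have DK0 : 0 < D + K * D + K by rewrite ltr_wpDl // addr_ge0 // mulr_ge0 // ltW.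
pose ep := eta / (D + K * D + K).
have ep0 : 0 < ep by rewrite divr_gt0.
have epE : ep * (D + K * D + K) = eta by rewrite divfK // gt_eqF.
have [rg rg0 Hg] := gJ ep0.
have [rf rf0 Hf] := f_strict ep0.
have D1 : 0 < D + 1 by rewrite ltr_wpDl.
have epD : 0 < ep * (D + 1) by rewrite mulr_gt0.
pose r := Num.min rg rf.
have r0 : 0 < r by rewrite lt_min rg0.
pose th := Num.min (Num.min del (r / (D + 1)))
                   (Num.min (del / (ep * (D + 1))) (Num.min ep (del / 2))).
have th0 : 0 < th by rewrite !lt_min del0 ep0 !divr_gt0.
have [t [q [/andP[t0 tth] qv Sq]]] := tangent_coneE Tv th0.
have tdel : t < del by rewrite (lt_le_trans tth) // !ge_min lexx.
have tr : t * (D + 1) <= r.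
  by rewrite -ler_pdivlMr // ltW // (lt_le_trans tth) // !ge_min lexx !orbT.
have tep : t * (ep * (D + 1)) <= del.
  by rewrite -ler_pdivlMr // ltW // (lt_le_trans tth) // !ge_min lexx !orbT.
have qep : `|q - v| <= ep by rewrite (le_trans qv) // !ge_min lexx !orbT.
have qdel : `|q - v| <= del / 2 by rewrite (le_trans qv) // !ge_min lexx !orbT.
pose x := xb + t *: (d + u).
have xxb : x - xb = t *: (d + u) by rewrite /x addrC addKr.
have nx : `|x - xb| = t * D by rewrite xxb normrZ gtr0_norm.
have xr : `|x - xb| <= r.
  by rewrite nx (le_trans _ tr) // ler_pM2l // lerDl.
have xbr : `|xb - xb| <= r by rewrite subrr normr0 ltW.
have rrg : r <= rg by rewrite ge_min lexx.
have rrf : r <= rf by rewrite ge_min lexx orbT.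
have Hgx := Hg xb x (le_trans xbr rrg) (le_trans xr rrg).
have Hfx := Hf xb x (le_trans xbr rrf) (le_trans xr rrf).
have gpw : `|g x - (g xb + t *: q) - (- (t *: w))| <= t * (ep * (D + 1)).
  have -> : g x - (g xb + t *: q) - (- (t *: w)) =
      (g x - g xb - (x - xb) *m J) - t *: (q - v).
    rewrite xxb vE -scalemxAl mulmxDl; move: (g x) (g xb) (d *m J) (u *m J) => a b c b'.
    by apply/rowP => i; rewrite !mxE; ring.
  rewrite (le_trans (ler_normB _ _)) // normrZ gtr0_norm // mulrDr mulr1 mulrDr lerD //.
    by rewrite (le_trans Hgx) // nx mulrCA.
  by rewrite ler_pM2l.
have := Hdel t (g xb + t *: q) x (- (t *: w)).
rewrite t0 tdel subr_ray.
have -> : x - (xb + t *: d) = t *: u by rewrite /x subr_ray addrAC subrr add0r.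
rewrite normrN !normrZ gtr0_norm // => /(_ isT Sq) H.
have {}H : f xb <= f x + K * (t * (ep * (D + 1)) + e / K * (t * `|w|)).
  apply: (le_trans (H _ _ _ _ _)).
  - rewrite mulrC ler_pM2r // -(subrKA v) (le_trans (ler_normD _ _)) //; lra.
  - rewrite mulrC ler_pM2r //; lra.
  - rewrite mulrC ler_pM2r //; lra.
  - by move=> z Nz; rewrite dotNr dotZr wN // mulr0 oppr0.
  - exact: le_trans gpw tep.
  - by rewrite lerD2l ler_pM2l // lerD2r.
move: Hfx; rewrite nx xxb dotZr ler_norml => /andP[_ Hfx].
have eK : K * (e / K * (t * `|w|)) = t * (e * `|w|) by field; rewrite gt_eqF.
rewrite -lerBlDr -(ler_pM2l t0).
move: H; rewrite mulrDr eK => H; rewrite -epE.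
move: (dot gf (d + u)) Hfx => G Hfx; nra.
Qed.

Hypothesis Td : tangent_cone S (g xb) (d *m J).
Hypothesis gfd : dot gf d <= 0.

Lemma critical_gradient0 : dot gf d = 0.
Proof.
apply/eqP; rewrite eq_le gfd /=.
have [rho rho0 H] := first_order_growth ltr01.
have := H (d *m J) 0 0 Td; rewrite subrr !normr0 mul0mx !addr0 mulr0 oppr0.
by apply; rewrite ?ltW // => u _; rewrite dot0r.
Qed.

(** The growth estimate with v = d J and w = - u J, applied to small multiples of
    u and of - u. *)
Lemma gradient0_on_orthogonal u : orthN (u *m J) -> dot gf u = 0.
Proof.
have ge0 w : orthN (w *m J) -> 0 <= dot gf w.
  move=> wN; rewrite -oppr_le0; apply/ler_addgt0Pr => eta eta0; rewrite add0r.
  have w1 : 0 < `|w *m J| + 1 by rewrite ltr_wpDl.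
  have e0 : 0 < eta / (`|w *m J| + 1) by rewrite divr_gt0.
  have [rho rho0 H] := first_order_growth e0.
  have D0 : 0 < `|w| + `|w *m J| + 1 by rewrite ltr_wpDl // addr_ge0.
  have [s s0 sE] : exists2 s, 0 < s & s * (`|w| + `|w *m J| + 1) = rho.
    by exists (rho / (`|w| + `|w *m J| + 1)); rewrite ?divr_gt0 // divfK // gt_eqF.
  have := H (d *m J) (s *: w) (- (s *: (w *m J))) Td.
  rewrite subrr normr0 normrN !normrZ (gtr0_norm s0) dotDr critical_gradient0 add0r dotZr.
  move=> /(_ (ltW rho0)) {}H.
  have {}H : - (eta / (`|w *m J| + 1) * (s * `|w *m J|)) <= s * dot gf w.
    apply: H.
    - by rewrite -sE ler_pM2l // -addrA lerDl addr_ge0.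
    - by rewrite -sE ler_pM2l // addrAC lerDr addr_ge0.
    - by move=> z Nz; rewrite dotNr dotZr wN // mulr0 oppr0.
    - by rewrite -scalemxAl addrK.
  rewrite -(ler_pM2l s0) mulrN lerNl (le_trans _ H) // lerN2.
  rewrite mulrCA ler_pM2l // mulrAC ler_pdivrMr // ler_pM2l // lerDl //.
move=> uN; apply/eqP; rewrite eq_le ge0 // andbT -oppr_ge0 -dotNr ge0 //.
by move=> z Nz; rewrite mulNmx dotNr uN // oppr0.
Qed.

(** The functional v |-> - <gf, v A>: solve v = u J + w with w orthogonal to the
    normals and take minus the slope of f along u. *)
Definition transversal_multiplier : 'rV[R]_m := - (gf *m A^T).

Lemma dot_transversal_multiplier v : dot transversal_multiplier v = - dot gf (v *m A).
Proof. by rewrite dotNl dot_mulmx. Qed.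

(** u and (u J) A have images under J that differ by a vector orthogonal to the
    normals, so gf does not distinguish them. *)
Lemma transversal_multiplier_stationary : gf + transversal_multiplier *m J^T = 0.
Proof.
apply/rowP => j; rewrite -[LHS]dot_delta [RHS]mxE; set u := delta_mx 0 j.
rewrite dotDl -dot_mulmx dot_transversal_multiplier -dotBr.
apply: gradient0_on_orthogonal => z Nz.
have -> : (u - u *m J *m A) *m J = u *m J *m B.
  by rewrite mulmxBl {1}(AB (u *m J)) addrAC subrr add0r.
exact: BN.
Qed.

(** The growth estimate applied to the splitting of v - d J, whose two parts are
    O(|v - d J|). *)
Lemma transversal_multiplier_regular_normal :
  regular_normal_cone (tangent_cone S (g xb)) (d *m J) transversal_multiplier.
Proof.
split => // e e0.
have [CA CA0 HA] := mulmx_bound A.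
have [CB CB0 HB] := mulmx_bound B.
have e'0 : 0 < e / CB by rewrite divr_gt0.
have [rho rho0 H] := first_order_growth e'0.
pose r := rho / (1 + CA + CB).
have C0 : 0 < 1 + CA + CB by rewrite !addr_gt0.
have r0 : 0 < r by rewrite divr_gt0.
have rE : (1 + CA + CB) * r = rho by rewrite mulrC divfK // gt_eqF.
apply/nbhs_ballP; exists r => //= v; rewrite -ball_normE /= distrC => /ltW vr Tv.
rewrite dot_transversal_multiplier; set h := v - d *m J in vr *.
have hA := HA h; have hB := HB h.
have CAr : CA * `|h| <= CA * r by rewrite ler_pM2l.
have CBr : CB * `|h| <= CB * r by rewrite ler_pM2l.
have CAr0 : 0 < CA * r by rewrite mulr_gt0.
have CBr0 : 0 < CB * r by rewrite mulr_gt0.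
have := H v (h *m A) (h *m B) Tv; rewrite dotDr critical_gradient0 add0r.
have -> : e * `|h| = e / CB * (CB * `|h|) by field; rewrite gt_eqF.
move=> {}H; rewrite lerNl; apply: le_trans (H _ _ _ _ _).
- by rewrite lerN2 ler_pM2l.
- by rewrite -/h; lra.
- lra.
- lra.
- by move=> z; exact: BN.
- by rewrite -addrA -AB /h addrC subrK.
Qed.

Variables (f2 : R) (g2 : 'rV[R]_m).
Hypothesis f_Taylor : forall e, 0 < e -> exists2 r, 0 < r & forall t, 0 < t < r ->
  `|f (xb + t *: d) - f xb - t * dot gf d - 2^-1 * t ^+ 2 * f2| <= e * t ^+ 2.
Hypothesis g_Taylor : forall e, 0 < e -> exists2 r, 0 < r & forall t, 0 < t < r ->
  `|g (xb + t *: d) - g xb - t *: (d *m J) - (2^-1 * t ^+ 2) *: g2| <= e * t ^+ 2.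

(** Exact penalty at x = xb + t d + s z and p = y + t d J + s w', where
    s = t^2 / 2 and z J = w - g2 + wB.  The shift s wB absorbs the component of
    w - g2 outside the range of J, and all errors are o(s); the first-order
    term t <gf, d> vanishes. *)
Lemma second_order_inequality w : second_tangent_set S (g xb) (d *m J) w ->
  dot transversal_multiplier w <= f2 + dot g2 transversal_multiplier.
Proof.
move=> Tw; rewrite (dotC g2) -lerBlDr -dotBr dot_transversal_multiplier.
pose z := (w - g2) *m A; pose wB := - ((w - g2) *m B).
have zE : z *m J = w - g2 + wB by rewrite {1}(AB (w - g2)) /wB addrK.
have wBN : orthN wB by move=> u Nu; rewrite dotNr BN // oppr0.
rewrite -/z lerNl; apply/ler_addgt0Pr => eta eta0.
have [K K0 HK] := exact_penalty.
pose W := `|wB|; pose Z := `|z| + 3.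
have nW0 : 0 <= W by exact: normr_ge0.
have W0 : 0 < W + 1 by rewrite ltr_wpDl.
have Z0 : 0 < Z by rewrite ltr_wpDl.
have KW0 : 0 < 2 * K * (W + 1) by rewrite !mulr_gt0.
pose e' := eta / (2 * K * (W + 1)).
have e'0 : 0 < e' by rewrite divr_gt0.
have e'E : K * e' * (W + 1) = eta / 2.
  by rewrite /e'; field; rewrite !gt_eqF.
have ZK0 : 0 < 2 * Z * (1 + K) by rewrite !mulr_gt0 // addr_gt0.
pose ep := eta / (2 * Z * (1 + K)).
have ep0 : 0 < ep by rewrite divr_gt0.
have epE : ep * Z * (1 + K) = eta / 2.
  by rewrite /ep; field; rewrite !gt_eqF // addr_gt0.
have [del del0 Hdel] := HK _ e'0.
have [r1 r10 Hg] := gJ ep0.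
have [r2 r20 Hf] := f_strict ep0.
have [r3 r30 HgT] := g_Taylor ep0.
have [r4 r40 HfT] := f_Taylor ep0.
pose r := Num.min r1 r2.
have r0 : 0 < r by rewrite lt_min r10.
(* t D bounds every displacement that has to stay below del or r. *)
pose D := `|d| + `|z| + `|w| + W + 1 + ep + ep * Z.
have nd0 := normr_ge0 d; have nz0 := normr_ge0 z; have nw0 := normr_ge0 w.
have epZ0 : 0 < ep * Z by rewrite mulr_gt0.
have D0 : 0 < D by rewrite /D; lra.
pose th := Num.min (Num.min (Num.min 1 ep) (Num.min r3 r4))
                   (Num.min (del / D) (Num.min (r / D) del)).
have th0 : 0 < th by rewrite !lt_min ltr01 ep0 r30 r40 del0 !divr_gt0.
have [t [w' [/andP[t0 tth] w'w Sp]]] := second_tangent_setE Tw th0.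
have t1 : t <= 1 by rewrite ltW // (lt_le_trans tth) // !ge_min lexx.
have tr3 : t < r3 by rewrite (lt_le_trans tth) // !ge_min lexx !orbT.
have tr4 : t < r4 by rewrite (lt_le_trans tth) // !ge_min lexx !orbT.
have tdel : t < del by rewrite (lt_le_trans tth) // !ge_min lexx !orbT.
have tD : t * D <= del.
  by rewrite -ler_pdivlMr // ltW // (lt_le_trans tth) // !ge_min lexx !orbT.
have tDr : t * D <= r.
  by rewrite -ler_pdivlMr // ltW // (lt_le_trans tth) // !ge_min lexx !orbT.
have w'ep : `|w' - w| <= ep by rewrite (le_trans w'w) // !ge_min lexx !orbT.
pose s := 2^-1 * t ^+ 2.
have s0 : 0 < s by rewrite mulr_gt0 ?exprn_gt0.
have ts : t ^+ 2 = 2 * s by rewrite /s; field.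
have st : s <= t * t by rewrite -expr2 ts; lra.
have stt : s <= t by rewrite (le_trans st) // ler_piMl // ltW.
pose x0 := xb + t *: d; pose x := x0 + s *: z.
have xx0 : x - x0 = s *: z by rewrite /x addrC addKr.
have nz : `|x - x0| = s * `|z| by rewrite xx0 normrZ gtr0_norm.
have x0b : `|x0 - xb| <= t * `|d|.
  by rewrite /x0 addrC addKr normrZ gtr0_norm.
have part (a b : R) : 0 <= a -> a <= D -> 0 <= b -> b <= t -> b * a <= t * D.
  by move=> *; rewrite ler_pM.
have x0r : `|x0 - xb| <= r.
  by rewrite (le_trans x0b) // (le_trans _ tDr) // part // ?(ltW t0) // /D; lra.
have xr : `|x - xb| <= r.
  rewrite -(subrKA x0) (le_trans (ler_normD _ _)) // nz (le_trans _ tDr) //.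
  apply: (@le_trans _ _ (t * (`|d| + `|z|))).
    by rewrite mulrDr addrC lerD // ler_wpM2r.
  by rewrite part // ?addr_ge0 ?(ltW t0) // /D; lra.
have rr1 : r <= r1 by rewrite ge_min lexx.
have rr2 : r <= r2 by rewrite ge_min lexx orbT.
have Hgx := Hg x0 x (le_trans x0r rr1) (le_trans xr rr1).
have Hfx := Hf x0 x (le_trans x0r rr2) (le_trans xr rr2).
have t3 : 0 < t < r3 by rewrite t0.
have t4 : 0 < t < r4 by rewrite t0.
have HgTt := HgT t t3; have HfTt := HfT t t4.
pose p := g xb + t *: (d *m J) + s *: w'.
have gpw : `|g x - p - s *: wB| <= s * (ep * Z).
  have -> : g x - p - s *: wB = (g x - g x0 - (x - x0) *m J)
      + (g x0 - g xb - t *: (d *m J) - s *: g2) - s *: (w' - w).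
    rewrite xx0 -scalemxAl zE /p; move: (g x) (g x0) (g xb) (d *m J) => a b c e.
    by apply/rowP => i; rewrite !mxE; ring.
  rewrite (le_trans (ler_normB _ _)) //.
  have -> : s * (ep * Z) = (ep * (s * `|z|) + ep * t ^+ 2) + s * ep.
    by rewrite ts /Z; ring.
  rewrite lerD //; last by rewrite normrZ gtr0_norm // ler_pM2l.
  rewrite (le_trans (ler_normD _ _)) // lerD //.
  by rewrite (le_trans Hgx) // nz.
have H : f xb <= f x + K * (`|g x - p - s *: wB| + e' * `|s *: wB|).
  apply: (Hdel t) => //.
  - by rewrite t0.
  - rewrite /p addrC addKr normrZ gtr0_norm //.
    have : `|w'| <= `|w| + ep by rewrite -(subrK w w') (le_trans (ler_normD _ _)) // addrC
        lerD2l.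
    move=> nw'; apply: (@le_trans _ _ (t * t * D)).
      by rewrite ler_pM ?(ltW s0) // (le_trans nw') // /D; lra.
    by rewrite -mulrA mulrC ler_wpM2r // ltW.
  - rewrite -/x0 nz; apply: (@le_trans _ _ (t * t * D)).
      by rewrite ler_pM ?(ltW s0) // /D; lra.
    by rewrite -mulrA mulrC ler_wpM2r // ltW.
  - rewrite normrZ gtr0_norm // -/W; apply: (@le_trans _ _ (t * t * D)).
      by rewrite ler_pM ?(ltW s0) // /D; lra.
    by rewrite -mulrA mulrC ler_wpM2r // ltW.
  - by move=> u Nu; rewrite dotZr wBN // mulr0.
  - by rewrite (le_trans gpw) // (le_trans _ tD) // part // ?(ltW s0) ?(ltW epZ0) // /D; lra.
have {}H : f xb <= f x + K * (s * (ep * Z) + e' * (s * W)).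
  rewrite (le_trans H) // lerD2l ler_pM2l // lerD // normrZ gtr0_norm //.
move: Hfx; rewrite nz xx0 dotZr ler_norml => /andP[_ Hfx].
move: HfTt; rewrite critical_gradient0 mulr0 subr0 -/s -/x0 ts ler_norml => /andP[_ HfTt].
rewrite -lerBlDr -(ler_pM2l s0).
have e1 : s * eta = s * (ep * Z * (1 + K)) + s * (K * e' * (W + 1)).
  by rewrite epE e'E; field.
have e2 : 0 <= s * (K * e').
  by apply: ltW; apply: mulr_gt0 => //; exact: mulr_gt0.
have e3 : ep * (s * `|z|) + ep * (2 * s) + s * ep = s * (ep * Z) by rewrite /Z; ring.
have e4 : 0 < s * ep by rewrite mulr_gt0.
rewrite mulrBr mulrN e1.
move: (dot gf z) (f x) (f x0) (f xb) Hfx HfTt H => G fx fx0 fxb Hfx HfTt H.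
lra.
Qed.

End Optimality.

(** * Uniqueness of the multiplier *)

Section Uniqueness.
Variables (R : realType) (m : nat).

(** The orthogonal complement of w is closed and convex. *)
Lemma orthogonal_clarke (S : set 'rV[R]_m) x d l w :
  dir_clarke_normal_cone S x d l ->
  (forall u, dir_normal_cone S x d u -> dot u w = 0) -> dot l w = 0.
Proof.
move=> Nl wN; pose H := [set u : 'rV[R]_m | dot u w = 0].
have Hcl : closed H.
  apply: (@closed_comp _ _ (fun u : 'rV[R]_m => dot u w) [set s : R | s = 0]).
    move=> u _; exact: (@cvg_dot R m _ (nbhs u) _ id (cst w) u w cvg_id (cvg_cst w)).
  exact: closed_eq.
have hullH : convex_hull (dir_normal_cone S x d) `<=` H.
  apply: smallest_sub => [|u Nu]; last exact: wN.
  move=> u v k; rewrite !inE /H /= => u0 v0.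
  by rewrite -[X in dot X w]/(k%:num *: u + (1 - k%:num) *: v) dotDl !dotZl u0 v0 !mulr0 addr0.
exact: (Hcl _ (closure_subset hullH Nl)).
Qed.

End Uniqueness.

Theorem corollary5 (R : realType) (n m : nat)
    (f : 'rV[R]_n -> R^o) (g : 'rV[R]_n -> 'rV[R]_m) (Lam : set 'rV[R]_m)
    (xb d : 'rV[R]_n)
    (f_C2 : C2 f) (g_C2 : C2 g) (Lam_closed : closed Lam)
    (xb_opt : local_optimal_solution f g Lam xb)
    (d_crit : critical_cone f g Lam xb d)
    (nondeg : dir_nondegenerate g Lam xb d) :
  exists l0 : 'rV[R]_m,
    [/\ strong_multipliers f g Lam xb d = [set l0],
        multipliers f g Lam xb d = [set l0],
        clarke_multipliers f g Lam xb d = [set l0] &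
        (0 <= (dot d (d *m hessian (lagrangian f g l0) xb))%:E
              - support_function
                  (second_tangent_set Lam (g xb) (d *m 'J g xb)) l0)%E].
Proof.
have C1g := C2_C1 g_C2; have C1f := C2_C1 f_C2.
have [df d2f] := f_C2; have [dg d2g] := g_C2.
have [_ /nbhs_ballP[r0 /= r00 Hr0]] := xb_opt.
have f_min : exists2 r, 0 < r & forall x, `|x - xb| <= r -> Lam (g x) -> f xb <= f x.
  exists (r0 / 2) => [|x xr]; first by rewrite divr_gt0.
  apply: Hr0; rewrite -ball_normE /= distrC (le_lt_trans xr) //.
  by rewrite ltr_pdivrMr // ltr_pMr // ltr1n.
have [Td gfd] := d_crit.
have N0 : dir_normal_cone Lam (g xb) (d *m 'J g xb) 0.
  have [t [dk [t0 dcvg Sk]]] := Td.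
  exists t, dk, (fun=> 0); split => //; first exact: cvg_cst.
  by move=> k; split => // e e0; apply: filterE => y _; rewrite dot0l mulr_ge0 // ltW.
have [A [B [AB BN NP]]] := transversal_splitting N0 nondeg.
have gJ : strictly_diff g xb ('J g xb) by exact: C1_strictly_diff.
have g_cont := C2_continuous g_C2.
have f_strict e : 0 < e -> exists2 r, 0 < r & forall x x',
    `|x - xb| <= r -> `|x' - xb| <= r ->
    `|f x' - f x - dot (gradient f xb) (x' - x)| <= e * `|x' - x|.
  move=> e0; have [r rr Hr] := C1_strict xb C1f e0.
  by exists r => // x x' xr x'r; rewrite dot_gradient; exact: Hr.
pose l0 := transversal_multiplier (gradient f xb) A.
have grad_L l : gradient (lagrangian f g l) xb = gradient f xb + l *m ('J g xb)^T.
  by apply: gradient_lagrangian.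
have l0_stat : gradient (lagrangian f g l0) xb = 0.
  rewrite grad_L.
  exact: (transversal_multiplier_stationary g_cont gJ Lam_closed AB BN f_strict f_min Td gfd).
have l0_reg := transversal_multiplier_regular_normal g_cont gJ Lam_closed AB BN f_strict
    f_min Td gfd.
have l0_dir := regular_normal_tangent_cone Lam_closed l0_reg.
have clarkeI l : dir_normal_cone Lam (g xb) (d *m 'J g xb) l ->
    dir_clarke_normal_cone Lam (g xb) (d *m 'J g xb) l.
  by move=> Nl; apply: subset_closure; exact: sub_gen_smallest.
have statE l : gradient (lagrangian f g l) xb = 0 ->
    l *m ('J g xb)^T = - gradient f xb.
  by rewrite grad_L addrC => /eqP; rewrite addr_eq0 => /eqP.
have uniq l : clarke_multipliers f g Lam xb d l -> l = l0.
  move=> [lstat lN]; apply/eqP; rewrite -subr_eq0; apply/eqP; apply: nondeg.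
    by rewrite mulmxBl (statE l lstat) (statE l0 l0_stat) subrr.
  apply: NP => w wN; rewrite dotBl (orthogonal_clarke lN wN) (wN _ l0_dir) subrr //.
exists l0; split.
- apply/seteqP; split=> l /= => [[ls lr]|->]; last by split.
  apply: uniq; split => //; apply: clarkeI; exact: regular_normal_tangent_cone.
- apply/seteqP; split=> l /= => [[ls lN]|->]; last by split.
  by apply: uniq; split => //; exact: clarkeI.
- apply/seteqP; split=> l /= => [|->]; first exact: uniq.
  by split => //; exact: clarkeI.
rewrite sube_ge0; last by apply/orP; right.
apply: ge_ereal_sup => _ [w Tw <-]; rewrite lee_fin.
rewrite (hessian_lagrangian _ _ _ f_C2 g_C2).
apply: (second_order_inequality g_cont gJ Lam_closed AB BN f_strict f_min Td gfd) => //.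
- move=> e e0; apply: (C2_Taylor f_C2 erefl) => //.
  by rewrite dot_gradient.
- by move=> e e0; exact: C2_Taylor_vec.
Qed.
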